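(* Let $\alpha>1$, and for each $d\ge1$ let $\boldsymbol{\gamma}_d=(\gamma_{d,1},\ldots,\gamma_{d,d})$ satisfy $1\ge\gamma_{d,1}\ge\ldots\ge\gamma_{d,d}>0$. Assume that $$t_{\boldsymbol{\gamma}}:=\inf\Big\{s\ge0\colon\sup_{d\ge1}\frac{\sum_{j=1}^d\gamma_{d,j}^s}{\ln(d+1)}<\infty\Big\}<1,$$ and put $\tilde\alpha=\min\{\alpha,1/t_{\boldsymbol{\gamma}}\}$ (with $1/0=\infty$). Then for each $t\in(0,\frac{\tilde\alpha-1}{2})$ there are a constant $c_{\alpha,\tilde\alpha,t}$ and an exponent $\beta(\alpha,\tilde\alpha,t)$, neither depending on the dimension $d$ (nor on $N$ and $\Lambda$), such that for every $d\ge1$, every $N\ge1$, and every multiple rank-1 lattice $\Lambda=\Lambda(\boldsymbol{z}_1,M_1,\ldots,\boldsymbol{z}_L,M_L)$ for which, with $I=A_d(N)$, $I=\bigcup_{\ell=1}^LI_\ell$, $L\le\max(3\ln|A_d(N)|,1)$, $M_1=\ldots=M_L\le3|A_d(N)|$, and $M:=|\Lambda|$ satisfies $2|A_d(N)|<M<9|A_d(N)|\max(\ln|A_d(N)|,1)$, one has $$\sup_{\|f|\mathcal{H}_{\alpha,\boldsymbol{\gamma}_d}(\mathbb{T}^d)\|\le1}\|f-\operatorname{S}_{A_d(N)}^\Lambda f\,|\,L_\infty(\mathbb{T}^d)\|<c_{\alpha,\tilde\alpha,t}\,d^{\,\beta(\alpha,\tilde\alpha,t)}M^{-t},$$ i.e.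 tractability (a bound of order $M^{-t}$ with constant depending at most polynomially on $d$) holds for each such $t$.
   Context: $\mathbb{T}\sim[0,1)$, and $c_{\boldsymbol{h}}(f)=\int_{\mathbb{T}^d}f(\boldsymbol{x})\mathrm{e}^{-2\pi\mathrm{i}\boldsymbol{h}\cdot\boldsymbol{x}}\,\mathrm{d}\boldsymbol{x}$. The weight function is $r_d(\alpha,\boldsymbol{\gamma}_d,\boldsymbol{h})=\prod_{j=1}^d\max(1,\gamma_{d,j}^{-1}|h_j|^\alpha)$ for $\boldsymbol{h}\in\mathbb{Z}^d$. The weighted Korobov space $\mathcal{H}_{\alpha,\boldsymbol{\gamma}_d}(\mathbb{T}^d)$ consists of all $f\in L_1(\mathbb{T}^d)$ with $\|f|\mathcal{H}_{\alpha,\boldsymbol{\gamma}_d}(\mathbb{T}^d)\|=\left(\sum_{\boldsymbol{h}\in\mathbb{Z}^d}r_d(\alpha,\boldsymbol{\gamma}_d,\boldsymbol{h})|c_{\boldsymbol{h}}(f)|^2\right)^{1/2}<\infty$; functions are identified with their continuous representatives, and point values refer to these. The frequency sets are $A_d(N)=\{\boldsymbol{h}\in\mathbb{Z}^d\colon r_d(\alpha,\boldsymbol{\gamma}_d,\boldsymbol{h})\le N\}$. The constant and the exponent may depend on $\alpha,\tilde\alpha,t$ and on the whole family of weights $(\boldsymbol{\gamma}_d)_{d\ge1}$. For $\boldsymbol{z}\in\mathbb{Z}^d$, $M'\in\mathbb{N}$, the rank-1 lattice is $\Lambda(\boldsymbol{z},M')=\{\frac{j}{M'}\boldsymbol{z}\bmod\boldsymbol{1}\colon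 j=0,\ldots,M'-1\}\subset\mathbb{T}^d$; a multiple rank-1 lattice is $\Lambda(\boldsymbol{z}_1,M_1,\ldots,\boldsymbol{z}_L,M_L)=\bigcup_{\ell=1}^L\Lambda(\boldsymbol{z}_\ell,M_\ell)$ with $L\in\mathbb{N}$, $\boldsymbol{z}_\ell\in\mathbb{Z}^d$, $M_\ell\in\mathbb{N}$. Given a finite $I\subset\mathbb{Z}^d$ and these parameters, define recursively the pairwise disjoint sets $$I_\ell=\Big\{\boldsymbol{h}\in I\setminus\bigcup_{j=1}^{\ell-1}I_j\colon \boldsymbol{h}\cdot\boldsymbol{z}_\ell\not\equiv\boldsymbol{k}\cdot\boldsymbol{z}_\ell\ (\mathrm{mod}\ M_\ell)\text{ for all }\boldsymbol{k}\in I\setminus\{\boldsymbol{h}\}\Big\},\quad\ell=1,\ldots,L,$$ and $$\operatorname{S}_I^\Lambda f(\boldsymbol{x})=\sum_{\ell=1}^L\sum_{\boldsymbol{h}\in I_\ell}\hat f_{\boldsymbol{h}}\,\mathrm{e}^{2\pi\mathrm{i}\boldsymbol{h}\cdot\boldsymbol{x}},\qquad \hat f_{\boldsymbol{h}}=\frac{1}{M_\ell}\sum_{j=0}^{M_\ell-1}f\Big(\frac{j\boldsymbol{z}_\ell}{M_\ell}\Big)\mathrm{e}^{-2\pi\mathrm{i}j\,\boldsymbol{h}\cdot\boldsymbol{z}_\ell/M_\ell}\quad\text{for }\boldsymbol{h}\in I_\ell.$$ *)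

(* Defs.v *)
From HB Require Import structures.
From mathcomp Require Import all_boot all_order all_algebra finmap.
From mathcomp Require Import all_classical all_reals all_analysis.
From mathcomp Require Export complex.

Set Implicit Arguments.
Unset Strict Implicit.
Unset Printing Implicit Defensive.

Import Order.TTheory GRing.Theory Num.Theory.
Import numFieldNormedType.Exports.

Local Open Scope classical_set_scope.
Local Open Scope ring_scope.

Section unit_interval.
Context {R : realType}.

Definition lebesgue01 : set (measurableTypeR R) -> \bar R :=
  mrestr lebesgue_measure (measurable_itv `[(0 : R), 1[).

HB.instance Definition _ := Measure.on lebesgue01.

Let lebesgue01_setT : lebesgue01 setT = 1%E.
Proof.
by rewrite /lebesgue01 /mrestr setTI lebesgue_measure_itv/= lte01 oppr0 adde0.
Qed.

HB.instance Definition _ :=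
  Measure_isProbability.Build _ _ _ lebesgue01 lebesgue01_setT.

End unit_interval.

(* A function on T^d is represented by a function on [d.-tuple R]; its values
   outside [0,1)^d play no role, as [torus_measure] is concentrated there. *)
Definition torus_pt (R : realType) (d : nat) := d.-tuple (measurableTypeR R).

Section torus_measure.
Context {R : realType}.

Definition point_cons (d : nat) (p : measurableTypeR R * torus_pt R d) :
  torus_pt R d.+1 := [the d.+1.-tuple _ of p.1 :: p.2].

Let measurable_point_cons d : measurable_fun setT (@point_cons d).
Proof. by apply: measurable_cons => //=. Qed.

HB.instance Definition _ d :=
  isMeasurableFun.Build _ _ _ _ (@point_cons d) (@measurable_point_cons d).

(* The d-fold product of [lebesgue01]. *)
Fixpoint torus_measure (d : nat) : probability (torus_pt R d) R :=
  match d with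
  | 0 => @dirac _ (torus_pt R 0) [tuple] R
  | d'.+1 => distribution (lebesgue01 \x torus_measure d')%E (@point_cons d')
  end.

End torus_measure.

Section functions.
Context {R : realType}.
Local Open Scope complex_scope.

Definition expi (x : R) : R[i] := cos x +i* sin x.

Variable d : nat.
Implicit Types (f g : torus_pt R d -> R[i]) (h k z : 'rV[int]_d).

Definition L1 f : Prop :=
  (torus_measure d).-integrable setT (EFin \o (fun x => complex.Re (f x))) /\
  (torus_measure d).-integrable setT (EFin \o (fun x => complex.Im (f x))).

Definition torus_integral f : R[i] :=
  Rintegral (torus_measure d) setT (fun x => complex.Re (f x)) +i*
  Rintegral (torus_measure d) setT (fun x => complex.Im (f x)).

Definition Linfty_norm f : \bar R :=
  Lnorm (torus_measure d) +oo%E (fun x => (Normc.normc (f x))%:E).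

Definition dotp_real h (x : torus_pt R d) : R :=
  \sum_(i < d) (h 0 i)%:~R * tnth x i.

Definition fourier_coef f h : R[i] :=
  torus_integral (fun x => f x * expi (- (2 * pi * dotp_real h x))).

(* Reduction mod 1 of a point of R^d to [0,1)^d. *)
Definition mod1 (y : 'I_d -> R) : torus_pt R d :=
  [tuple y i - (Num.floor (y i))%:~R | i < d].

(* Continuity for the topology of T^d = R^d / Z^d: the 1-periodic extension
   to R^d of the restriction of [g] to [0,1)^d is continuous. *)
Definition torus_continuous g : Prop :=
  continuous (fun y : 'rV[R]_d => complex.Re (g (mod1 (y 0)))) /\
  continuous (fun y : 'rV[R]_d => complex.Im (g (mod1 (y 0)))).

(* The continuous function that is a.e. equal to [f] (unique on [0,1)^d),
   with the dummy value [f] if there is none. *)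
Definition continuous_rep f : torus_pt R d -> R[i] :=
  xget f [set g | torus_continuous g /\ {ae torus_measure d, forall x, f x = g x}].

End functions.

Section korobov.
Context {R : realType}.
Variables (d : nat) (alpha : R) (gamma : 'I_d -> R).

Definition korobov_weight (h : 'rV[int]_d) : R :=
  \prod_(j < d) Num.max 1 ((gamma j)^-1 * (`|h 0 j|)%:~R `^ alpha).

Definition korobov_norm (f : torus_pt R d -> R[i]) : \bar R :=
  ((\esum_(h in [set: 'rV[int]_d])
     (korobov_weight h * Normc.normc (fourier_coef f h) ^+ 2)%:E)
   `^ 2^-1)%E.

Definition korobov_space : set (torus_pt R d -> R[i]) :=
  [set f | L1 f /\ (korobov_norm f < +oo)%E].

Definition freq_set (N : R) : set 'rV[int]_d :=
  [set h | korobov_weight h <= N].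

End korobov.

(* A multiple rank-1 lattice is given by [L] and by the values at l < L of
   [z : nat -> 'rV[int]_d] and [Ms : nat -> nat]; indices start at 0. *)
Section lattice.
Context {R : realType}.
Variable d : nat.
Implicit Types (h k : 'rV[int]_d) (I : set 'rV[int]_d).

Definition dotp (h k : 'rV[int]_d) : int := \sum_(i < d) h 0 i * k 0 i.

Definition lattice_point (z : 'rV[int]_d) (M j : nat) : torus_pt R d :=
  mod1 (fun i => j%:R / M%:R * (z 0 i)%:~R).

Definition rank1_lattice (z : 'rV[int]_d) (M : nat) : set (torus_pt R d) :=
  [set lattice_point z M j | j in `I_M].

Variables (L : nat) (z : nat -> 'rV[int]_d) (Ms : nat -> nat).

Definition multi_lattice : set (torus_pt R d) :=
  \bigcup_(l in `I_L) rank1_lattice (z l) (Ms l).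

Definition new_freqs (I U : set 'rV[int]_d) (l : nat) : set 'rV[int]_d :=
  [set h | (I `\` U) h /\
    forall k, (I `\ h) k -> (dotp h (z l) != dotp k (z l) %[mod Ms l])%Z].

(* The union of the I_j over j < l. *)
Fixpoint used_freqs (I : set 'rV[int]_d) (l : nat) : set 'rV[int]_d :=
  match l with
  | 0 => set0
  | l'.+1 => used_freqs I l' `|` new_freqs I (used_freqs I l') l'
  end.

Definition freqs (I : set 'rV[int]_d) (l : nat) : set 'rV[int]_d :=
  new_freqs I (used_freqs I l) l.

Definition lattice_coef (g : torus_pt R d -> R[i]) (l : nat) (h : 'rV[int]_d) :
    R[i] :=
  (Ms l)%:R^-1 * \sum_(j < Ms l) g (lattice_point (z l) (Ms l) j) *
    expi (- (2 * pi * j%:R * (dotp h (z l))%:~R / (Ms l)%:R)).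

Definition lattice_approx (I : set 'rV[int]_d) (f : torus_pt R d -> R[i])
    (x : torus_pt R d) : R[i] :=
  \sum_(l < L) \sum_(h \in freqs I l)
    lattice_coef (continuous_rep f) l h * expi (2 * pi * dotp_real h x).

End lattice.

Section decay.
Context {R : realType}.
Variable gamma : forall d : nat, 'I_d -> R.

Definition t_gamma : \bar R :=
  ereal_inf [set s%:E | s in [set s : R | 0 <= s /\
    (ereal_sup [set ((\sum_(j < d) gamma j `^ s) / ln d.+1%:R)%:E
               | d in [set d : nat | (1 <= d)%N]] < +oo)%E]].

(* [inve] satisfies 0^-1 = +oo. *)
Definition alpha_tilde (alpha : R) : \bar R :=
  Order.min alpha%:E (t_gamma^-1)%E.

End decay.

(* Main.v *)
Require Import Defs.
From mathcomp Require Import all_boot all_order all_algebra finmap.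
From mathcomp Require Import all_classical all_reals all_analysis.
From mathcomp Require Import measurable_realfun.
From mathcomp Require Import ring lra zify.
Import Order.TTheory GRing.Theory Num.Theory.
Import numFieldNormedType.Exports.
Local Open Scope classical_set_scope.
Local Open Scope ring_scope.
Set Implicit Arguments.
Unset Strict Implicit.
Unset Printing Implicit Defensive.

(** Write r for the Korobov weight, e_h for the character of frequency h, c_h
for the Fourier coefficients of f in the unit ball, and A = A_d(N).

The series of the c_h e_h converges absolutely: by Cauchy-Schwarz the sum of
the |c_h| over h outside A is at most the square root of the sum of 1 / r(h)
over these h ([sum_normc_tail]).  Its sum g is continuous on the torus and has
the same Fourier coefficients as f, so f = g almost everywhere by the
injectivity of the Fourier transform on L1 ([fourier_coef_inj]), and the point
values of f that the algorithm samples are those of g ([continuous_repE]).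

The algorithm reproduces e_k for k in A, and it maps e_k for k outside A to a
sum of at most L characters, because on each of the L lattices at most one of
the frequencies to be computed there is an alias of k
([lattice_error_polynomial]).  Hence the error at any point is at most
(1 + L) times the sum of the |c_k| over k outside A
([lattice_error_series], [korobov_lattice_error]).

Dimension enters only through the sum of r(h)^-s over all h.  It is at most a
product of factors 1 + O(gamma_j^s) as soon as alpha s > 1, hence at most
exp(O(sum_j gamma_j^s)) ([korobov_weight_sum]), which is polynomial in d when
sum_j gamma_j^s = O(ln(d + 1)).  With K a bound on this sum one has
|A| <= K N^s and a tail of at most K^(1/2) N^(-(1-s)/2); eliminating N turns
this into |A|^(-(1/s-1)/2) times a power of K.  The condition on t says exactly
that some s admits all of this together with t < (1/s - 1) / 2
([exponent_choice]); the room left between these two numbers absorbs L and the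
logarithm in the comparison of M with |A| ([error_bound]).

The injectivity of the Fourier transform comes from a measure-theoretic
principle: an integrable u orthogonal to an algebra V of bounded measurable
functions vanishes almost everywhere as soon as the sets {v < a}, v in V,
generate the sigma-algebra up to null sets ([ae_eq0_of_orthogonal]).  For V
the trigonometric polynomials these sets include the half-spaces {x_i < b},
which are arcs in one coordinate ([fourier_uniqueness]). *)

(** * Polynomials approximating a step *)

Lemma one_sub_ge_bernoulli (R : realType) (x : R) n : 0 <= x <= 1 ->
  1 - n%:R * x <= (1 - x) ^+ n.
Proof.
move=> /andP[x0 x1]; elim: n => [|n IH]; first by rewrite mul0r subr0 expr0.
rewrite exprS.
have := ler_wpM2l (_ : 0 <= 1 - x) IH; rewrite subr_ge0 => /(_ x1).
apply: le_trans; rewrite -natr1.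
have : 0 <= n%:R * (x * x) by rewrite mulr_ge0// mulr_ge0.
nra.
Qed.

Lemma one_sub_exp_upper (R : realType) (x : R) n : 0 <= x <= 1 ->
  (1 - x) ^+ n <= (1 + n%:R * x)^-1.
Proof.
move=> /andP[x0 x1]; rewrite -div1r ler_pdivlMr; last first.
  by rewrite ltr_wpDr// mulr_ge0.
elim: n => [|n IH]; first by rewrite expr0 mul0r addr0 mulr1.
have e0 : 0 <= (1 - x) ^+ n by apply: exprn_ge0; lra.
apply: le_trans IH; rewrite exprS -mulrA mulrCA ler_wpM2l//.
rewrite -natr1.
have : 0 <= n%:R * (x * x) by rewrite mulr_ge0// mulr_ge0.
nra.
Qed.

(** The exponent n 2^n makes the limit 0 at the threshold v = 1/2 itself, so that
the limit is an indicator everywhere and no null set has to be discarded. *)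
Definition step_approx (R : realType) (n : nat) (v : R) : R :=
  (1 - v ^+ n) ^+ (n * 2 ^ n).

Lemma step_approx01 (R : realType) n (v : R) : 0 <= v <= 1 ->
  0 <= step_approx n v <= 1.
Proof.
move=> /andP[v0 v1]; have h0 : 0 <= v ^+ n by apply: exprn_ge0.
have h1 : v ^+ n <= 1 by apply: exprn_ile1.
by apply/andP; split; [apply: exprn_ge0 | apply: exprn_ile1]; lra.
Qed.

(** One factor of sqrt q ^ n already compensates the factor n. *)
Lemma cvg_mulrn_expr (R : realType) (q : R) : 0 <= q < 1 ->
  (fun n => n%:R * q ^+ n) @ \oo --> (0 : R).
Proof.
move=> /andP[q0 q1]; set r := Num.sqrt q.
have r1 : r < 1 by rewrite -sqrtr1 ltr_sqrt.
have r0 : 0 <= r by exact: sqrtr_ge0.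
have x0 : 0 < 1 - r by lra.
have nr n : n%:R * r ^+ n <= (1 - r)^-1.
  rewrite -[leRHS]div1r ler_pdivlMr//.
  have /= := @one_sub_exp_upper R (1 - r) n; rewrite subKr => /(_ _) h.
  have {}h : r ^+ n <= (1 + n%:R * (1 - r))^-1 by apply: h; lra.
  have p0 : 0 <= n%:R * (1 - r) by rewrite mulr_ge0// ltW.
  rewrite mulrAC mulrC; apply: le_trans (_ : (1 + n%:R * (1 - r))^-1 * (n%:R * (1 - r)) <= 1).
    by rewrite ler_wpM2r.
  by rewrite mulrC ler_pdivrMr; lra.
have c0 : (fun n => (1 - r)^-1 * r ^+ n) @ \oo --> (0 : R).
  rewrite -[X in _ --> X](mulr0 (1 - r)^-1); apply: cvgM; first exact: cvg_cst.
  by apply: cvg_expr; rewrite ger0_norm.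
apply: (squeeze_cvgr _ (cvg_cst 0) c0); apply: nearW => n.
rewrite mulr_ge0 ?exprn_ge0//= -[q]sqr_sqrtr// -/r -exprM mulnC exprM expr2 mulrA.
by rewrite ler_wpM2r// exprn_ge0.
Qed.

(** With E = n 2^n one has E v^n = n (2v)^n, which tends to 0 for v < 1/2 and is at
least n for v >= 1/2; the two Bernoulli-type inequalities bound (1 - v^n)^E by
1 - E v^n from below and by 1 / (1 + E v^n) from above. *)
Lemma cvg_step_approx (R : realType) (v : R) : 0 <= v <= 1 ->
  (fun n => step_approx n v) @ \oo --> ((v < 2^-1)%R%:R : R).
Proof.
move=> /andP[v0 v1].
have vn0 n : 0 <= v ^+ n by apply: exprn_ge0.
have vn1 n : v ^+ n <= 1 by apply: exprn_ile1.
have Ev n : (n * 2 ^ n)%:R * v ^+ n = n%:R * (2 * v) ^+ n :> R.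
  by rewrite natrM natrX -mulrA exprMn.
have s01 n : 0 <= step_approx n v <= 1 by apply: step_approx01; rewrite v0 v1.
have [vlt|vge] := ltP v 2^-1.
  have c0 : (fun n => 1 - n%:R * (2 * v) ^+ n) @ \oo --> (1%:R : R).
    rewrite -[X in _ --> X]subr0; apply: cvgB; first exact: cvg_cst.
    by apply: cvg_mulrn_expr; lra.
  apply: (squeeze_cvgr _ c0 (cvg_cst _)); apply: nearW => n.
  have /andP[_ ->] := s01 n; rewrite andbT -Ev.
  by apply: one_sub_ge_bernoulli; rewrite vn0 vn1.
apply: (squeeze_cvgr _ (cvg_cst _) cvg_harmonic); apply: nearW => n.
have /andP[-> _] := s01 n; rewrite /=.
apply: le_trans (one_sub_exp_upper _ _) _; first by rewrite vn0 vn1.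
rewrite Ev /harmonic lef_pV2 ?posrE//; last first.
  by rewrite ltr_wpDr// mulr_ge0// exprn_ge0// mulr_ge0.
rewrite -natr1 addrC lerD2l ler_peMr// exprn_ege1//; lra.
Qed.

(** * Orthogonality to an algebra of bounded functions *)

Lemma eq_indic (R : realType) T (A B : set T) x :
  (A x <-> B x) -> \1_A x = \1_B x :> R.
Proof.
by move=> h; rewrite !indicE; congr ((nat_of_bool _)%:R); apply/idP/idP; rewrite !inE => /h.
Qed.

Section bounded_measurable.
Context d (T : measurableType d) (R : realType).
Implicit Types phi psi : T -> R.

Definition bounded_measurable phi :=
  measurable_fun setT phi /\ exists B : R, forall x, `|phi x| <= B.

Lemma bounded_measurable_cst c : bounded_measurable (cst c).
Proof. by split => //; exists `|c|. Qed.

Lemma bounded_measurableM phi psi :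
  bounded_measurable phi -> bounded_measurable psi ->
  bounded_measurable (fun x => phi x * psi x).
Proof.
move=> [mphi [A Ab]] [mpsi [B Bb]]; split; first exact: measurable_funM.
by exists (A * B) => x; rewrite normrM ler_pM.
Qed.

Lemma bounded_measurableB phi psi :
  bounded_measurable phi -> bounded_measurable psi ->
  bounded_measurable (fun x => phi x - psi x).
Proof.
move=> [mphi [A Ab]] [mpsi [B Bb]]; split; first exact: measurable_funB.
by exists (A + B) => x; apply: le_trans (ler_normB _ _) _; rewrite lerD.
Qed.

Lemma bounded_measurable_indic A : measurable A ->
  bounded_measurable (\1_A).
Proof.
move=> mA; split; first exact: measurable_indic.
by exists 1 => x; rewrite indicE; case: (_ \in _); rewrite ?normr1 ?normr0.
Qed.

Lemma integrable_mul_bounded (mu : {measure set T -> \bar R}) (u : T -> R) phi :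
  mu.-integrable setT (EFin \o u) -> bounded_measurable phi ->
  mu.-integrable setT (EFin \o (fun x => u x * phi x)).
Proof.
move=> iu [mphi [B Bb]].
apply: (@eq_integrable _ _ _ mu _ measurableT ((EFin \o u) \* (EFin \o phi))%E) => //.
apply: integrableMl => //.
exists B; split; first exact: num_real.
by move=> M BM x _; apply: le_trans (Bb x) _; exact: ltW.
Qed.

Lemma integrable_bounded_measurable (P : probability T R) (f : T -> R) :
  bounded_measurable f -> P.-integrable setT (EFin \o f).
Proof.
move=> [mf [B Bf]]; apply: measurable_bounded_integrable => //.
  by rewrite -ge0_fin_numE// fin_num_measure.
exists B; split; first exact: num_real.
by move=> M BM x _; apply: le_trans (Bf x) _; exact: ltW.
Qed.

Lemma Rintegral_probability_cst (P : probability T R) (c : R) : Rintegral P setT (fun=> c) = c.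
Proof.
by rewrite Rintegral_cst//; have /= -> := @probability_setT _ _ _ P; rewrite mulr1.
Qed.

End bounded_measurable.

Section annihilator.
Context d (T : measurableType d) (R : realType) (mu : {measure set T -> \bar R}).
Variables (u : T -> R) (V : set (T -> R)).
Hypothesis iu : mu.-integrable setT (EFin \o u).
Hypothesis Vcst : forall c, V (cst c).
Hypothesis VD : forall v w, V v -> V w -> V (fun x => v x + w x).
Hypothesis VM : forall v w, V v -> V w -> V (fun x => v x * w x).
Hypothesis Vmeas : forall v, V v -> measurable_fun setT v.
Hypothesis Vbnd : forall v, V v -> exists B : R, forall x, `|v x| <= B.
Hypothesis Vorth : forall v, V v -> \int[mu]_x (u x * v x) = 0.

Lemma bounded_measurable_mem v : V v -> bounded_measurable v.
Proof. by move=> Vv; split; [exact: Vmeas|exact: Vbnd]. Qed.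

(** Testing against all of V, and not only against 1, makes this class stable
under multiplication by V ([annihilatedM]). *)
Definition annihilated (phi : T -> R) := bounded_measurable phi /\
  forall v, V v -> \int[mu]_x (u x * (phi x * v x)) = 0.

Lemma annihilated_mem v : V v -> annihilated v.
Proof.
move=> Vv; split; first exact: bounded_measurable_mem.
by move=> w Vw; apply: Vorth; exact: VM.
Qed.

Lemma annihilatedM phi v : annihilated phi -> V v ->
  annihilated (fun x => phi x * v x).
Proof.
move=> [bphi ophi] Vv; split; first exact: (bounded_measurableM bphi (bounded_measurable_mem Vv)).
move=> w Vw; under eq_Rintegral do rewrite -mulrA.
by apply: ophi; exact: VM.
Qed.

Lemma annihilatedB phi psi : annihilated phi -> annihilated psi ->
  annihilated (fun x => phi x - psi x).
Proof.
move=> [bphi ophi] [bpsi opsi]; split; first exact: bounded_measurableB.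
move=> w Vw; have bw := bounded_measurable_mem Vw.
under eq_Rintegral do rewrite mulrBl mulrBr.
by rewrite RintegralB ?ophi ?opsi ?subrr//;
  apply: integrable_mul_bounded iu _; exact: bounded_measurableM.
Qed.

(** Dominated convergence, with dominating function a multiple of |u|. *)
Lemma annihilated_lim (phi_ : nat -> T -> R) phi B :
  (forall n, annihilated (phi_ n)) ->
  (forall n x, `|phi_ n x| <= B) ->
  (forall x, phi_ n x @[n --> \oo] --> phi x) -> annihilated phi.
Proof.
move=> aphi_ Bphi cphi.
have mphi : measurable_fun setT phi.
  apply: (@measurable_fun_cvg _ _ _ _ phi_) => [n|x _]; last exact: cphi.
  by case: (aphi_ n) => -[].
have bphi : bounded_measurable phi.
  split => //; exists B => x.
  have : (fun n => `|phi_ n x|) @ \oo --> `|phi x| by apply: cvg_norm; exact: cphi.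
  by apply: (@closed_cvg _ _ _ _ _ (fun y => y <= B)); [exact: closed_le|exact: nearW].
split=> // v Vv; have [mv [C Cv]] := bounded_measurable_mem Vv.
have int_ n := integrable_mul_bounded iu (bounded_measurableM (aphi_ n).1 (conj mv (ex_intro _ C Cv))).
have int := integrable_mul_bounded iu (bounded_measurableM bphi (conj mv (ex_intro _ C Cv))).
have int0 n : (\int[mu]_x (u x * (phi_ n x * v x))%:E = 0)%E.
  apply/eqP; rewrite -fine_eq0; first by apply/eqP; exact: ((aphi_ n).2 _ Vv).
  exact: (integrable_fin_num measurableT (int_ n)).
have cint x : (fun n => (u x * (phi_ n x * v x))%:E) @ \oo --> (u x * (phi x * v x))%:E.
  apply: cvg_EFin; first exact: nearW.
  by apply: cvgM; [exact: cvg_cst|apply: cvgM; [exact: cphi|exact: cvg_cst]].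
have dom n x : (`|(u x * (phi_ n x * v x))%:E| <= (B * C)%:E * `|(u x)%:E|)%E.
  by rewrite lee_fin normrM mulrC ler_wpM2r// normrM ler_pM.
have [_ _] := @dominated_convergence _ _ _ mu setT measurableT
  (fun n x => (u x * (phi_ n x * v x))%:E) (fun x => (u x * (phi x * v x))%:E)
  (fun x => (B * C)%:E * `|(u x)%:E|)%E (fun n => measurable_int mu (int_ n))
  (measurable_int mu int) (aeW _ (fun x _ => cint x))
  (integrableZl measurableT _ (integrable_abse iu)) (aeW _ (fun x n _ => dom n x)).
under eq_fun do rewrite int0.
by move=> /(cvg_unique _ (cvg_cst _)) c0; rewrite /Rintegral -c0.
Qed.

(** Phrased through multiplication of the whole class by the indicator, the
property passes to intersections at once, so that these sets form a
sigma-algebra without any monotone class argument. *)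
Definition annihilated_set (A : set T) := measurable A /\
  forall phi, annihilated phi -> annihilated (fun x => phi x * \1_A x).

Lemma annihilated_set_setC A : annihilated_set A -> annihilated_set (~` A).
Proof.
move=> [mA hA]; split; first exact: measurableC.
move=> phi aphi.
rewrite (_ : (fun _ => _) = fun x => phi x - phi x * \1_A x).
  by apply: annihilatedB => //; exact: hA.
apply/funext => x; rewrite indicC indicE; case: (_ \in _) => /=;
  by rewrite ?mulr1 ?mulr0 ?subrr ?subr0.
Qed.

Lemma annihilated_set_setI A B : annihilated_set A -> annihilated_set B ->
  annihilated_set (A `&` B).
Proof.
move=> [mA hA] [mB hB]; split; first exact: measurableI.
move=> phi aphi; under eq_fun do rewrite indicI /= mulrA.
exact/hB/hA.
Qed.

Lemma annihilated_set0 : annihilated_set set0.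
Proof.
split => // phi aphi; rewrite (_ : (fun _ => _) = cst 0).
  exact/annihilated_mem/Vcst.
by apply/funext => x; rewrite indic0 mulr0.
Qed.

Lemma annihilated_set_lim (A_ : nat -> set T) (A : set T) :
  (forall n, annihilated_set (A_ n)) -> measurable A ->
  (forall x, \forall n \near \oo, A_ n x <-> A x) -> annihilated_set A.
Proof.
move=> hA_ mA cA; split => // phi aphi.
have [_ [B Bphi]] := aphi.1.
apply: (@annihilated_lim (fun n x => phi x * \1_(A_ n) x) _ B).
- by move=> n; exact: (hA_ n).2.
- move=> n x; rewrite indicE; case: (_ \in _) => /=; rewrite ?mulr1// mulr0 normr0.
  exact: le_trans (Bphi x).
- move=> x; apply: cvgM; first exact: cvg_cst.
  apply: cvg_near_cst; near=> n; apply: eq_indic.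
  by near: n; exact: cA.
Unshelve. all: by end_near. Qed.

Lemma sigma_algebra_annihilated_set : sigma_algebra setT annihilated_set.
Proof.
split; first exact: annihilated_set0.
  by move=> A hA; rewrite setTD; exact: annihilated_set_setC.
move=> A_ hA_.
apply: (@annihilated_set_lim (fun n => \big[setU/set0]_(i < n) A_ i)).
- elim=> [|n IH]; first by rewrite big_ord0; exact: annihilated_set0.
  rewrite big_ord_recr /= -[X in annihilated_set X]setCK setCU.
  by apply/annihilated_set_setC/annihilated_set_setI; exact: annihilated_set_setC.
- by apply: bigcup_measurable => n _; case: (hA_ n).
- move=> x; have [[k _ Akx]|nA] := pselect ((\bigcup_k A_ k) x).
    exists k.+1 => // n /= kn; split => _; first by exists k.
    by rewrite -bigcup_mkord; exists k.
  exists 0 => // n _; split => // ; rewrite -bigcup_mkord => -[k _ Akx].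
  by case: nA; exists k.
Qed.

Lemma mem_exprn v n : V v -> V (fun x => v x ^+ n).
Proof.
move=> Vv; elim: n => [|n IH].
  by rewrite (_ : (fun _ => _) = cst 1)//; apply/funext => x; rewrite expr0.
by under eq_fun do rewrite exprS; exact: VM.
Qed.

(** The polynomials [step_approx n] in v belong to V and converge boundedly to the
indicator of {v < 1/2}. *)
Lemma annihilated_set_lt_half v : V v -> (forall x, 0 <= v x <= 1) ->
  annihilated_set [set x | v x < 2^-1].
Proof.
move=> Vv v01.
have mA : measurable [set x | v x < 2^-1].
  rewrite -[X in measurable X]setTI.
  exact: (measurable_fun_ltr (Vmeas Vv) (measurable_cst _)).
split => // phi aphi; have [_ [B Bphi]] := aphi.1.
apply: (@annihilated_lim (fun n x => phi x * step_approx n (v x)) _ B).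
- move=> n; apply: annihilatedM => //; apply: (@mem_exprn (fun x => 1 - v x ^+ n)).
  rewrite (_ : (fun _ => _) = fun x => 1 + (-1) * v x ^+ n).
    apply: (@VD (cst 1)) => //; apply: (@VM (cst (-1))) => //; exact: mem_exprn.
  by apply/funext => x; rewrite mulN1r.
- move=> n x; rewrite normrM -[leRHS]mulr1 ler_pM//.
  by have /andP[s0 s1] := step_approx01 n (v01 x); rewrite ger0_norm.
- move=> x; apply: cvgM; first exact: cvg_cst.
  rewrite indicE (_ : (x \in _) = (v x < 2^-1)); first exact: cvg_step_approx.
  by apply/idP/idP; rewrite inE.
Qed.

(** An affine change of v brings its values into [0, 1] and a to 1/2. *)
Lemma annihilated_set_lt v a : V v -> annihilated_set [set x | v x < a].
Proof.
move=> Vv; have [B Bv] := Vbnd Vv.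
pose C := (2 * (1 + `|B| + `|a|))^-1.
have p0 : 0 < 2 * (1 + `|B| + `|a|) by have := normr_ge0 B; have := normr_ge0 a; lra.
have C0 : 0 < C by rewrite invr_gt0.
rewrite (_ : [set _ | _] = [set x | 2^-1 + C * (v x + (- a)) < 2^-1]).
  apply: annihilated_set_lt_half.
    apply: (@VD (cst 2^-1)) => //; apply: (@VM (cst C)) => //.
    exact: (@VD _ (cst (- a))).
  move=> x; have : `|C * (v x - a)| <= 2^-1.
    rewrite normrM gtr0_norm// /C ler_pdivrMl// mulrC mulrA mulVf// mul1r.
    apply: le_trans (ler_normB _ _) _; have := Bv x; have := ler_norm B.
    by lra.
  by rewrite ler_norml; lra.
apply/seteqP; split => x /=; first by move=> h; rewrite gtrDl pmulr_rlt0 ?subr_lt0.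
by rewrite gtrDl pmulr_rlt0// subr_lt0.
Qed.

Lemma annihilated_set_ae A A' : annihilated_set A -> measurable A' ->
  {ae mu, forall x, A x <-> A' x} -> annihilated_set A'.
Proof.
move=> [mA hA] mA' AA'; split=> // phi aphi.
split; first exact: (bounded_measurableM aphi.1 (bounded_measurable_indic R mA')).
move=> v Vv; have [_ /(_ _ Vv) <-] := hA _ aphi.
have bv := bounded_measurable_mem Vv.
have h E : measurable E ->
    measurable_fun setT (fun x => (u x * (phi x * \1_E x * v x))%:E).
  move=> mE; apply: (measurable_int mu); apply: integrable_mul_bounded iu _.
  apply: bounded_measurableM bv; apply: bounded_measurableM aphi.1 _.
  exact: bounded_measurable_indic.
congr fine; apply: ae_eq_integral => //; [exact: h|exact: h|].
apply: filterS AA' => x AA'x _; by rewrite /= (eq_indic R AA'x).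
Qed.

(** The annihilated sets form a sigma-algebra which contains the sets {v < a} and
is insensitive to null sets; once it is everything, u has integral 0 over each
measurable set. *)
Lemma ae_eq0_of_orthogonal (G : set (set T)) :
  G `<=` measurable -> measurable `<=` <<s G >> ->
  (forall B, G B -> exists v a, V v /\ {ae mu, forall x, v x < a <-> B x}) ->
  {ae mu, forall x, u x = 0}.
Proof.
move=> Gmeas measG GV.
have hA A : measurable A -> annihilated_set A.
  move=> /measG; apply: smallest_sub; first exact: sigma_algebra_annihilated_set.
  move=> B GB; have [v [a [Vv vB]]] := GV B GB.
  by apply: annihilated_set_ae (annihilated_set_lt a Vv) _ vB; exact: Gmeas.
have : ae_eq mu setT (EFin \o u) (cst 0)%E.
  apply: integral_ae_eq => // E _ mE.
  rewrite integral_cst// mul0e integral_mkcond.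
  have [bE /(_ _ (Vcst 1))] := (hA _ mE).2 _ (annihilated_mem (Vcst 1)).
  have iE := integrable_mul_bounded iu bE.
  rewrite /Rintegral => /eqP; rewrite fine_eq0; last first.
    apply: integrable_fin_num => //.
    by apply: eq_integrable iE => // x _ /=; rewrite mulr1.
  move=> /eqP i0; rewrite -[RHS]i0; apply: eq_integral => x _.
  rewrite patchE indicE /=; case: (_ \in _); by rewrite /= mul1r ?mulr1 ?mulr0.
by apply: filterS => x /(_ I) [].
Qed.

End annihilator.

(** * The torus measure *)

Lemma measurable_box (R : realType) d (B : 'I_d -> set (measurableTypeR R)) :
  (forall i, measurable (B i)) ->
  measurable [set x : torus_pt R d | forall i, B i (tnth x i)].
Proof.
move=> mB.
rewrite (_ : [set _ | _] = \bigcap_(i in [set: 'I_d]) (fun x : torus_pt R d => tnth x i) @^-1` B i).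
  apply: fin_bigcap_measurable => // i _; rewrite -[X in measurable X]setTI.
  exact: measurable_tnth.
by apply/seteqP; split => [x h i _|x h i]; exact: h.
Qed.

Lemma torus_measure_box (R : realType) d (B : 'I_d -> set (measurableTypeR R)) :
  (forall i, measurable (B i)) ->
  torus_measure d [set x : torus_pt R d | forall i, B i (tnth x i)] =
  (\prod_(i < d) @lebesgue01 R (B i))%E.
Proof.
elim: d B => [|d IH] B mB.
  by rewrite big_ord0 /= diracE mem_set//= => -[].
rewrite big_ord_recl -IH//= /distribution /pushforward -product_measure1E//.
  congr (product_measure1 _ _ _); apply/seteqP; split => [[a x] /= h|[a x] /= [h0 h] i].
    by split => [|i]; [exact: (h ord0)|move: (h (lift ord0 i)); rewrite tnthS].
  by case: (unliftP ord0 i) => [j ->|->]; rewrite ?tnthS ?tnth0//; exact: h.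
exact: (@measurable_box R d (fun i => B (lift ord0 i))).
Qed.

Lemma lebesgue01_itv (R : realType) (a b : R) : 0 <= a -> a <= b -> b <= 1 ->
  @lebesgue01 R `[a, b[%classic = (b - a)%:E.
Proof.
move=> a0 ab b1; rewrite /lebesgue01 /mrestr setIidl; last first.
  by apply: subset_itv; rewrite bnd_simp.
rewrite lebesgue_measure_itv /= lte_fin; case: ltP => [//|ba].
by rewrite (le_anti (introT andP (conj ab ba))) subrr.
Qed.

(** Stated because instance resolution does not reach the measure structure of
[torus_measure] by itself. *)
Instance torus_ae_filter (R : realType) d :
  Filter (nbhs (almost_everywhere (@torus_measure R d))) :=
  ae_filter_ringOfSetsType (@torus_measure R d).

Definition torus_cube (R : realType) d : set (torus_pt R d) :=
  [set x | forall i, `[0, 1[%classic (tnth x i)].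

Lemma ae_torus_interior (R : realType) d :
  {ae @torus_measure R d, forall x, forall i, 0 < tnth x i < 1}.
Proof.
pose C := [set x : torus_pt R d | forall i, `]0, 1[%classic (tnth x i)].
have mC : measurable C by exact: (@measurable_box R d (fun=> `]0, 1[%classic)).
exists (~` C); split; [exact: measurableC| |].
  have := probability_setC (torus_measure d) mC; rewrite /= => ->.
  rewrite (_ : torus_measure d _ = 1%E) ?subee//.
  rewrite (torus_measure_box (B := fun=> `]0, 1[%classic))// big1// => i _.
  rewrite /lebesgue01 /mrestr setIidl; last by apply: subset_itv; rewrite bnd_simp.
  by rewrite lebesgue_measure_itv /= lte_fin ltr01 oppr0 adde0.
by move=> x /= + h; apply => i; move: (h i); rewrite /= in_itv.
Qed.

Lemma torus_measure_box_gt0 (R : realType) d (a b : 'I_d -> R) :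
  (forall i, 0 <= a i) -> (forall i, a i < b i) -> (forall i, b i <= 1) ->
  (0 < @torus_measure R d [set x | forall i, `[a i, b i[%classic (tnth x i)])%E.
Proof.
move=> a0 ab b1; rewrite (torus_measure_box (B := fun i => `[a i, b i[%classic))//.
rewrite (eq_bigr (fun i => (b i - a i)%:E)); last first.
  by move=> i _; rewrite lebesgue01_itv// ltW.
by rewrite prodEFin lte_fin prodr_gt0// => i _; rewrite subr_gt0.
Qed.

Definition halfspace (R : realType) d (i : 'I_d) (b : R) : set (torus_pt R d) :=
  [set x | tnth x i < b].

Lemma measurable_halfspace (R : realType) d (i : 'I_d) (b : R) :
  measurable (halfspace i b).
Proof.
rewrite -[X in measurable X]setTI.
exact: (measurable_fun_ltr (@measurable_tnth _ (measurableTypeR R) d i) (measurable_cst b)).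
Qed.

(** The sigma-algebra of tuples is generated by the preimages of measurable sets
under the coordinates, and that of the line by the half-lines. *)
Lemma measurable_sub_halfspaces (R : realType) d :
  @measurable _ (torus_pt R d) `<=`
  <<s [set H | exists i b, H = @halfspace R d i b] >>.
Proof.
set G := [set H | _]; have sG : sigma_algebra setT (<<s G >>) by exact: smallest_sigma_algebra.
apply: smallest_sub => //.
suff H (i : 'I_d) : preimage_set_system [set: torus_pt R d] (fun x => tnth x i)
    (@measurable _ (measurableTypeR R)) `<=` <<s G >>.
  by elim/big_ind : _ => [A []|F F' hF hF' A [/hF|/hF']|i _] //.
move=> _ [B mB <-].
have : (@RGenInftyO.G R).-sigma.-measurable `<=`
   image_set_system setT (fun x : torus_pt R d => tnth x i) (<<s G >>).
  apply: smallest_sub; first exact: sigma_algebra_image.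
  move=> _ [b ->]; rewrite /image_set_system /= setTI.
  apply: sub_sigma_algebra; exists i, b.
  by apply/seteqP; split => x /=; rewrite in_itv.
by apply; rewrite -RGenInftyO.measurableE.
Qed.

(** * Trigonometric polynomials *)

(** The arc of length b starting at 0 is centred at b / 2, and the cosine of the
angle to its centre decreases with the distance on either side. *)
Lemma cos_gt_arc (R : realType) (b x : R) : 0 < b < 1 -> 0 < x < 1 ->
  (cos (pi * b) < cos (2 * pi * x - pi * b)) = (x < b).
Proof.
move=> /andP[b0 b1] /andP[x0 x1]; have p0 := pi_gt0 R.
have pib : (pi * b : R) \in `[0, pi] by rewrite in_itv /=; nra.
apply/idP/idP => [|xb].
  apply: contraTT; rewrite -!leNgt => bx.
  have [ypi|ypi] := leP (2 * pi * x - pi * b) pi.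
    by rewrite leNgt ltr_cos// -?leNgt; rewrite ?in_itv /=; nra.
  rewrite -(cosN (_ - _)) -cosD2pi leNgt ltr_cos// -?leNgt ?in_itv /= mulr2n; nra.
by rewrite -(cos_norm (_ - _)) ltr_cos// ?ltr_norml ?in_itv /= ?normr_ge0 ?ler_norml/=; nra.
Qed.

(** A linear span presented inductively: a property stable under linear combinations
need only be checked on cosines and sines. *)
Inductive trigpoly (R : realType) (d : nat) : set (torus_pt R d -> R) :=
| trigpoly_cos h : trigpoly (fun x => cos (2 * pi * dotp_real h x))
| trigpoly_sin h : trigpoly (fun x => sin (2 * pi * dotp_real h x))
| trigpolyD v w : trigpoly v -> trigpoly w -> trigpoly (fun x => v x + w x)
| trigpolyZ c v : trigpoly v -> trigpoly (fun x => c * v x).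

Arguments trigpoly_cos {R d} h.
Arguments trigpoly_sin {R d} h.

Section dotp_real.
Context (R : realType) (d : nat).
Implicit Types (h k : 'rV[int]_d) (x : torus_pt R d).

Lemma dotp_realDl h k x : dotp_real (h + k) x = dotp_real h x + dotp_real k x.
Proof.
by rewrite /dotp_real -big_split; apply: eq_bigr => i _ /=; rewrite mxE intrD mulrDl.
Qed.

Lemma dotp_realNl h x : dotp_real (- h) x = - dotp_real h x.
Proof.
by rewrite /dotp_real -sumrN; apply: eq_bigr => i _ /=; rewrite mxE intrN mulNr.
Qed.

Lemma dotp_realBl h k x : dotp_real (h - k) x = dotp_real h x - dotp_real k x.
Proof. by rewrite dotp_realDl dotp_realNl. Qed.

Lemma dotp_real0l x : dotp_real 0 x = 0.
Proof. by rewrite /dotp_real big1// => i _; rewrite mxE mul0r. Qed.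

Lemma dotp_real_delta i x : dotp_real (delta_mx 0 i) x = tnth x i.
Proof.
rewrite /dotp_real (bigD1 i)//= big1 => [|j ji]; rewrite mxE !eqxx /= ?mul1r ?addr0//.
by rewrite (negPf ji) mul0r.
Qed.

Lemma measurable_dotp_real h :
  measurable_fun setT (dotp_real h : torus_pt R d -> R).
Proof.
apply: measurable_sum => i; apply: measurable_funM => //.
exact: (@measurable_tnth _ (measurableTypeR R)).
Qed.

End dotp_real.

Section trigpoly.
Context (R : realType) (d : nat).
Implicit Types v w : torus_pt R d -> R.

Lemma trigpoly_cst c : trigpoly (cst c : torus_pt R d -> R).
Proof.
rewrite (_ : cst c = fun x => c * cos (2 * pi * dotp_real 0 x)); last first.
  by apply/funext => x; rewrite dotp_real0l mulr0 cos0 mulr1.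
exact/trigpolyZ/trigpoly_cos.
Qed.

Lemma trigpolyB v w : trigpoly v -> trigpoly w -> trigpoly (fun x => v x - w x).
Proof.
move=> tv tw; rewrite (_ : (fun _ => _) = fun x => v x + (-1) * w x).
  by apply: trigpolyD => //; exact: trigpolyZ.
by apply/funext => x; rewrite mulN1r.
Qed.

(** The addition formulas. *)
Lemma trigpolyM v w : trigpoly v -> trigpoly w -> trigpoly (fun x => v x * w x).
Proof.
have E (u u' : torus_pt R d -> R) : u = u' -> trigpoly u' -> trigpoly u by move=> ->.
move=> tv; elim: tv w => [h|h|v1 v2 _ IH1 _ IH2|c v1 _ IH] w tw; last 2 first.
- by under eq_fun do rewrite mulrDl; apply: trigpolyD; [exact: IH1|exact: IH2].
- by under eq_fun do rewrite -mulrA; apply: trigpolyZ; exact: IH.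
- elim: tw => [k|k|w1 w2 _ IH1 _ IH2|c w1 _ IH].
  + apply: (E _ _ _ (trigpolyZ 2^-1 (trigpolyD (trigpoly_cos (h + k)) (trigpoly_cos (h - k))))).
    apply/funext => x; rewrite !(dotp_realDl, dotp_realNl) !(mulrDr (2 * pi)) !mulrN.
    by rewrite !(cosD, sinD, cosN, sinN); field.
  + apply: (E _ _ _ (trigpolyZ 2^-1 (trigpolyB (trigpoly_sin (h + k)) (trigpoly_sin (h - k))))).
    apply/funext => x; rewrite !(dotp_realDl, dotp_realNl) !(mulrDr (2 * pi)) !mulrN.
    by rewrite !(cosD, sinD, cosN, sinN); field.
  + by under eq_fun do rewrite mulrDr; apply: trigpolyD; [exact: IH1|exact: IH2].
  + by under eq_fun do rewrite mulrCA; apply: trigpolyZ; exact: IH.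
- elim: tw => [k|k|w1 w2 _ IH1 _ IH2|c w1 _ IH].
  + apply: (E _ _ _ (trigpolyZ 2^-1 (trigpolyD (trigpoly_sin (h + k)) (trigpoly_sin (h - k))))).
    apply/funext => x; rewrite !(dotp_realDl, dotp_realNl) !(mulrDr (2 * pi)) !mulrN.
    by rewrite !(cosD, sinD, cosN, sinN); field.
  + apply: (E _ _ _ (trigpolyZ 2^-1 (trigpolyB (trigpoly_cos (h - k)) (trigpoly_cos (h + k))))).
    apply/funext => x; rewrite !(dotp_realDl, dotp_realNl) !(mulrDr (2 * pi)) !mulrN.
    by rewrite !(cosD, sinD, cosN, sinN); field.
  + by under eq_fun do rewrite mulrDr; apply: trigpolyD; [exact: IH1|exact: IH2].
  + by under eq_fun do rewrite mulrCA; apply: trigpolyZ; exact: IH.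
Qed.

Lemma measurable_trigpoly v : trigpoly v -> measurable_fun setT v.
Proof.
have m h : measurable_fun setT (fun x : torus_pt R d => 2 * pi * dotp_real h x).
  by apply: measurable_funM => //; exact: measurable_dotp_real.
elim => [h|h|v1 v2 _ m1 _ m2|c v1 _ m1].
- have mcos : measurable_fun setT (@cos R).
    by apply: continuous_measurable_fun; exact: continuous_cos.
  exact: (measurableT_comp mcos (m h)).
- have msin : measurable_fun setT (@sin R).
    by apply: continuous_measurable_fun; exact: continuous_sin.
  exact: (measurableT_comp msin (m h)).
- exact: measurable_funD.
- by apply: measurable_funM.
Qed.

Lemma bounded_trigpoly v : trigpoly v -> exists B : R, forall x, `|v x| <= B.
Proof.
elim => [h|h|v1 v2 _ [B1 b1] _ [B2 b2]|c v1 _ [B1 b1]].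
- by exists 1 => x; exact: cos_max.
- by exists 1 => x; exact: sin_max.
- by exists (B1 + B2) => x; apply: le_trans (ler_normD _ _) _; rewrite lerD.
- by exists (`|c| * B1) => x; rewrite normrM ler_wpM2l.
Qed.

Lemma bounded_measurable_trigpoly v : trigpoly v -> bounded_measurable v.
Proof. by move=> tv; split; [exact: measurable_trigpoly|exact: bounded_trigpoly]. Qed.

End trigpoly.

(** * Uniqueness of Fourier coefficients *)

Section uniqueness.
Context (R : realType) (d : nat) (u : torus_pt R d -> R).
Hypothesis iu : (torus_measure d).-integrable setT (EFin \o u).
Hypothesis ucos : forall h : 'rV[int]_d,
  Rintegral (torus_measure d) setT (fun x => u x * cos (2 * pi * dotp_real h x)) = 0.
Hypothesis usin : forall h : 'rV[int]_d,
  Rintegral (torus_measure d) setT (fun x => u x * sin (2 * pi * dotp_real h x)) = 0.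

Let integrable_mul_trigpoly v : trigpoly v ->
  (torus_measure d).-integrable setT (EFin \o (fun x => u x * v x)).
Proof.
move=> tv; apply: integrable_mul_bounded => //.
exact: bounded_measurable_trigpoly.
Qed.

Lemma trigpoly_orth v : trigpoly v ->
  Rintegral (torus_measure d) setT (fun x => u x * v x) = 0.
Proof.
elim => [h|h|v1 v2 t1 i1 t2 i2|c v1 t1 i1].
- exact: ucos.
- exact: usin.
- under eq_Rintegral do rewrite mulrDr.
  by rewrite RintegralD ?i1 ?i2 ?addr0//; exact: integrable_mul_trigpoly.
- under eq_Rintegral do rewrite mulrCA.
  by rewrite RintegralZl ?i1 ?mulr0//; exact: integrable_mul_trigpoly.
Qed.

(** Half-spaces are arcs in one coordinate: on the open cube {x_i < b} is given by
the cosine of the angle between x_i and b / 2 for 0 < b < 1, and is empty or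
full otherwise. *)
Lemma halfspace_trigpoly (i : 'I_d) (b : R) :
  exists v a, trigpoly v /\ {ae torus_measure d, forall x, v x < a <-> halfspace i b x}.
Proof.
have [b0|b0] := leP b 0.
  exists (cst 0), 0; split; first exact: trigpoly_cst.
  apply: filterS (ae_torus_interior R d) => x /(_ i) /andP[x0 _].
  split; first by rewrite ltxx.
  by move=> xb; have := lt_trans x0 (lt_le_trans xb b0); rewrite ltxx.
have [b1|b1] := leP 1 b.
  exists (cst 0), 1; split; first exact: trigpoly_cst.
  apply: filterS (ae_torus_interior R d) => x /(_ i) /andP[_ x1].
  by split => // _; exact: lt_le_trans b1.
pose e : 'rV[int]_d := delta_mx 0 i.
exists (fun x => (- cos (pi * b)) * cos (2 * pi * dotp_real e x) +
            (- sin (pi * b)) * sin (2 * pi * dotp_real e x)), (- cos (pi * b)).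
split.
  by apply: trigpolyD; apply: trigpolyZ; [exact: trigpoly_cos|exact: trigpoly_sin].
apply: filterS (ae_torus_interior R d) => x /(_ i) x01.
rewrite /halfspace /= -(@cos_gt_arc _ b)//; last by rewrite b0.
by rewrite dotp_real_delta cosB ltrNr; split; lra.
Qed.

Lemma fourier_uniqueness : {ae torus_measure d, forall x, u x = 0}.
Proof.
apply: (@ae_eq0_of_orthogonal _ _ _ _ _ (@trigpoly R d) _ _ _ _ _ _ _
  [set H | exists i b, H = halfspace i b]) => //.
- by move=> c; exact: trigpoly_cst.
- by move=> v w; exact: trigpolyD.
- by move=> v w; exact: trigpolyM.
- by move=> v; exact: measurable_trigpoly.
- by move=> v; exact: bounded_trigpoly.
- by move=> v; exact: trigpoly_orth.
- by move=> _ [i [b ->]]; exact: measurable_halfspace.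
- exact: measurable_sub_halfspaces.
- by move=> _ [i [b ->]]; exact: halfspace_trigpoly.
Qed.

End uniqueness.

(** * Orthogonality of the characters *)

Lemma integral_lebesgue01 (R : realType) (f : R -> R) :
  measurable_fun setT f -> (exists B : R, forall x, `|f x| <= B) ->
  Rintegral (@lebesgue01 R) setT f =
  Rintegral (@lebesgue_measure R) `[0, 1] f.
Proof.
move=> mf [B Bf].
have bf : bounded_measurable (f : measurableTypeR R -> R) by split => //; exists B.
pose D : set (measurableTypeR R) := `[0, 1[%classic.
have mD : measurable D by exact: measurable_itv.
have if1 : (@lebesgue01 R).-integrable setT (EFin \o f).
  apply: measurable_bounded_integrable => //.
    by rewrite -ge0_fin_numE// fin_num_measure.
  exists B; split; first exact: num_real.
  by move=> M BM x _; apply: le_trans (Bf x) _; exact: ltW.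
have if2 : (@lebesgue_measure R).-integrable D (EFin \o f).
  apply: measurable_bounded_integrable => //.
  - apply: (@le_lt_trans _ _ 1%E); last exact: ltry.
    have := @lebesgue_measure_itv R `[0, 1[; rewrite /= lte_fin ltr01 oppr0 adde0 => h.
    by rewrite le_eqVlt; apply/orP; left; apply/eqP; exact: h.
  - by apply: measurable_funTS; exact: mf.
  exists B; split; first exact: num_real.
  by move=> M BM x _; apply: le_trans (Bf x) _; exact: ltW.
rewrite -Rintegral_itv_bndo_bndc//; congr fine.
transitivity (integral (@lebesgue01 R) D (EFin \o f)); last first.
  by apply: eq_measure_integral => A mA AD; rewrite /= /lebesgue01 /mrestr setIidl.
rewrite (@negligible_integral _ _ _ (@lebesgue01 R) setT (~` D))//.
- by rewrite setTD setCK.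
- exact: measurableC.
- by rewrite /= /lebesgue01 /mrestr setICl measure0.
Qed.

Lemma Rintegral01_derive (R : realType) (F f : R -> R) :
  (forall x : R, is_derive x 1 F (f x)) -> continuous f ->
  Rintegral (@lebesgue_measure R) `[0, 1] f = F 1 - F 0.
Proof.
move=> dF cf; rewrite /Rintegral (@continuous_FTC2 R f F 0 1)//.
- by apply: continuous_subspaceT.
- have cF x : {for x, continuous F}.
    by apply/differentiable_continuous/derivable1_diffP; have [] := dF x.
  split.
  + by move=> x _; have [] := dF x.
  + by apply: cvg_at_right_filter; exact: cF.
  + by apply: cvg_at_left_filter; exact: cF.
- by move=> x _; rewrite derive1E; have [_ ->] := dF x.
Qed.

Lemma cos_intmul2pi (R : realType) (n : int) : cos (2 * pi * n%:~R) = 1 :> R.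
Proof.
have H (m : nat) : cos (2 * pi * m%:R) = 1 :> R.
  elim: m => [|m IH]; first by rewrite mulr0 cos0.
  rewrite (_ : 2 * pi * m.+1%:R = 2 * pi * m%:R + pi *+ 2) ?cosD2pi//.
  by rewrite -natr1; ring.
case: n => m; first exact: H.
by rewrite NegzE mulrNz mulrN cosN; exact: H.
Qed.

Lemma sin_intmul2pi (R : realType) (n : int) : sin (2 * pi * n%:~R) = 0 :> R.
Proof. by apply: cos1sin0; rewrite cos_intmul2pi normr1. Qed.

Lemma is_derive_phase (R : realType) (n : int) (x : R) :
  is_derive x 1 (fun y : R => 2 * pi * (n%:~R * y)) (2 * pi * n%:~R).
Proof.
under eq_fun do rewrite mulrA.
by apply: is_derive_eq; rewrite /GRing.scale /= mulr1.
Qed.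

Lemma continuous_phase (R : realType) (n : int) :
  continuous (fun y : R => 2 * pi * (n%:~R * y)).
Proof.
move=> x; apply/differentiable_continuous/derivable1_diffP.
by have [] := is_derive_phase n x.
Qed.

Lemma phase_neq0 (R : realType) (n : int) : n != 0 -> 2 * pi * n%:~R != 0 :> R.
Proof.
move=> n0; apply: mulf_neq0; last by rewrite intr_eq0.
by apply: mulf_neq0 => //; rewrite gt_eqF// pi_gt0.
Qed.

Lemma Rintegral_lebesgue01_cos (R : realType) (n : int) :
  Rintegral (@lebesgue01 R) setT (fun x => cos (2 * pi * (n%:~R * x))) =
  (n == 0)%:R.
Proof.
have [->|n0] := eqVneq n 0.
  under eq_Rintegral do rewrite mul0r mulr0 cos0.
  exact: Rintegral_probability_cst.
have c0 := phase_neq0 R n0.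
have ccos : continuous (fun y : R => cos (2 * pi * (n%:~R * y))).
  by move=> x; apply: continuous_comp; [exact: continuous_phase|exact: continuous_cos].
rewrite integral_lebesgue01; last 2 first.
- exact: continuous_measurable_fun.
- by exists 1 => x; exact: cos_max.
have dF (x : R) : is_derive x 1
    (fun y : R => (2 * pi * n%:~R)^-1 * sin (2 * pi * (n%:~R * y)))
    (cos (2 * pi * (n%:~R * x))).
  have ds := @is_derive1_comp R sin (fun y => 2 * pi * (n%:~R * y)) x _ _
    (is_derive_sin _) (is_derive_phase n x).
  have dZ := is_deriveZ (2 * pi * n%:~R)^-1 ds.
  by apply: (@is_derive_eq _ _ _ _ _ _ _ _ dZ); rewrite /GRing.scale /= mulrC mulfK.
by rewrite (Rintegral01_derive dF)// mulr1 sin_intmul2pi !mulr0 sin0 mulr0 subrr.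
Qed.

Lemma Rintegral_lebesgue01_sin (R : realType) (n : int) :
  Rintegral (@lebesgue01 R) setT (fun x => sin (2 * pi * (n%:~R * x))) = 0.
Proof.
have [->|n0] := eqVneq n 0.
  under eq_Rintegral do rewrite mul0r mulr0 sin0.
  exact: Rintegral_probability_cst.
have c0 := phase_neq0 R n0.
have csin : continuous (fun y : R => sin (2 * pi * (n%:~R * y))).
  by move=> x; apply: continuous_comp; [exact: continuous_phase|exact: continuous_sin].
rewrite integral_lebesgue01; last 2 first.
- exact: continuous_measurable_fun.
- by exists 1 => x; exact: sin_max.
have dF (x : R) : is_derive x 1
    (fun y : R => - (2 * pi * n%:~R)^-1 * cos (2 * pi * (n%:~R * y)))
    (sin (2 * pi * (n%:~R * x))).
  have ds := @is_derive1_comp R cos (fun y => 2 * pi * (n%:~R * y)) x _ _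
    (is_derive_cos _) (is_derive_phase n x).
  have dZ := is_deriveZ (- (2 * pi * n%:~R)^-1) ds.
  apply: (@is_derive_eq _ _ _ _ _ _ _ _ dZ).
  by rewrite /GRing.scale /= !mulNr mulrN opprK mulrCA mulVf ?mulr1.
by rewrite (Rintegral01_derive dF)// mulr1 cos_intmul2pi !mulr0 cos0 subrr.
Qed.

Lemma Rintegral_prodM d1 d2 (T1 : measurableType d1) (T2 : measurableType d2)
    (R : realType) (P1 : probability T1 R) (P2 : probability T2 R)
    (a : T1 -> R) (b : T2 -> R) :
  bounded_measurable a -> bounded_measurable b ->
  Rintegral (P1 \x P2)%E setT (fun p => a p.1 * b p.2) =
  Rintegral P1 setT a * Rintegral P2 setT b.
Proof.
move=> ba bb.
have bab : bounded_measurable (fun p : T1 * T2 => a p.1 * b p.2).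
  case: ba bb => [ma [A Aa]] [mb [B Bb]]; split.
    by apply: measurable_funM; apply: measurableT_comp.
  by exists (A * B) => p; rewrite normrM ler_pM.
have iab : (P1 \x P2)%E.-integrable setT (EFin \o (fun p => a p.1 * b p.2)).
  exact: (@integrable_bounded_measurable _ _ _ (P1 \x P2)%E).
rewrite /Rintegral -(integral12_prod_meas1 iab).
have ib := @integrable_bounded_measurable _ _ _ P2 b bb.
have ia := @integrable_bounded_measurable _ _ _ P1 a ba.
have fb := integrable_fin_num measurableT ib.
rewrite -fineM//; last exact: integrable_fin_num.
congr fine; rewrite -[X in (_ * X)%E](fineK fb) -integralZr//.
apply: eq_integral => x _; rewrite /fubini_F /= (fineK fb) -integralZl//.
Qed.

Lemma torus_integralS (R : realType) d (f : torus_pt R d.+1 -> R) :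
  bounded_measurable f ->
  Rintegral (torus_measure d.+1) setT f =
  Rintegral (@lebesgue01 R \x torus_measure d)%E setT (fun p => f (point_cons p)).
Proof.
move=> [mf [B Bf]]; rewrite /Rintegral /= integral_distribution//.
  exact/measurable_EFinP.
apply: integrable_bounded_measurable; split; first exact: measurableT_comp.
by exists B => p; exact: Bf.
Qed.

Lemma dotp_real_cons (R : realType) d (h : 'rV[int]_d.+1) (p : measurableTypeR R * torus_pt R d) :
  dotp_real h (point_cons p) =
  (h 0 ord0)%:~R * p.1 + dotp_real (\row_j h 0 (lift ord0 j)) p.2.
Proof.
rewrite /dotp_real big_ord_recl tnth0; congr (_ + _).
by apply: eq_bigr => i _; rewrite mxE tnthS.
Qed.

Lemma rowv_eq0_cons d (h : 'rV[int]_d.+1) :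
  (h == 0) = (h 0 ord0 == 0) && (\row_j h 0 (lift ord0 j) == 0).
Proof.
apply/eqP/andP => [->|[/eqP h0 /eqP h1]].
  by rewrite mxE; split => //; apply/eqP/rowP => j; rewrite !mxE.
apply/rowP => i; rewrite !mxE; case: (unliftP ord0 i) => [j ->|->//].
by move/rowP : h1 => /(_ j); rewrite !mxE.
Qed.

(** The first coordinate splits off by the addition formulas and Fubini, so both
integrals vanish unless both the first coordinate and the rest of h do. *)
Lemma torus_integral_character (R : realType) d (h : 'rV[int]_d) :
  Rintegral (@torus_measure R d) setT (fun x => cos (2 * pi * dotp_real h x)) = (h == 0)%:R /\
  Rintegral (@torus_measure R d) setT (fun x => sin (2 * pi * dotp_real h x)) = 0.
Proof.
elim: d h => [|d IH] h.
  have E x : dotp_real h x = 0 :> R by rewrite /dotp_real big_ord0.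
  under eq_Rintegral do rewrite E mulr0 cos0.
  under [X in _ /\ X = _]eq_Rintegral do rewrite E mulr0 sin0.
  rewrite !Rintegral_probability_cst.
  by have -> : h == 0 by apply/eqP/rowP => -[].
set h' := \row_j h 0 (lift ord0 j).
have [C S] := IH h'.
have bc : bounded_measurable (fun x : measurableTypeR R => cos (2 * pi * ((h 0 ord0)%:~R * x))).
  split; last by exists 1 => x; exact: cos_max.
  apply: (measurableT_comp (continuous_measurable_fun (@continuous_cos R))).
  by apply: measurable_funM => //; exact: measurable_funM.
have bs : bounded_measurable (fun x : measurableTypeR R => sin (2 * pi * ((h 0 ord0)%:~R * x))).
  split; last by exists 1 => x; exact: sin_max.
  apply: (measurableT_comp (continuous_measurable_fun (@continuous_sin R))).
  by apply: measurable_funM => //; exact: measurable_funM.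
have bc' := bounded_measurable_trigpoly (@trigpoly_cos R d h').
have bs' := bounded_measurable_trigpoly (@trigpoly_sin R d h').
rewrite !torus_integralS; last 2 first.
- exact: bounded_measurable_trigpoly (trigpoly_sin h).
- exact: bounded_measurable_trigpoly (trigpoly_cos h).
under eq_Rintegral do rewrite dotp_real_cons mulrDr cosD.
under [X in _ /\ X = _]eq_Rintegral do rewrite dotp_real_cons mulrDr sinD.
have fstM (f : measurableTypeR R -> R) (g : torus_pt R d -> R) :
    bounded_measurable f -> bounded_measurable g ->
    bounded_measurable (fun p : measurableTypeR R * torus_pt R d => f p.1 * g p.2).
  move=> [mf [A Af]] [mg [B Bg]]; split.
    by apply: measurable_funM; apply: measurableT_comp.
  by exists (A * B) => p; rewrite normrM ler_pM.
have intM f g bf bg := @integrable_bounded_measurable _ _ _ (@lebesgue01 R \x torus_measure d)%E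
  _ (fstM f g bf bg).
rewrite RintegralB//; [|exact: (intM _ _ bc bc')|exact: (intM _ _ bs bs')].
rewrite RintegralD//; [|exact: (intM _ _ bs bc')|exact: (intM _ _ bc bs')].
have prodE f g bf bg := @Rintegral_prodM _ _ _ _ R (@lebesgue01 R) (@torus_measure R d) f g bf bg.
rewrite (prodE _ _ bc bc') (prodE _ _ bs bs') (prodE _ _ bs bc') (prodE _ _ bc bs') C S.
rewrite !mulr0 addr0 subr0 Rintegral_lebesgue01_sin mul0r; split => //.
by rewrite Rintegral_lebesgue01_cos rowv_eq0_cons -natrM mulnb.
Qed.

(** * The complex exponential *)

Section complex_exponential.
Context {R : realType}.
Local Open Scope complex_scope.
Implicit Types (x y : R) (a b : R[i]).

Lemma normcD a b : Normc.normc (a + b) <= Normc.normc a + Normc.normc b.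
Proof. exact: le_normcD. Qed.

Lemma normcN a : Normc.normc (- a) = Normc.normc a.
Proof. exact: normcN. Qed.

Lemma normcB a b : Normc.normc (a - b) <= Normc.normc a + Normc.normc b.
Proof. by rewrite -(normcN b); exact: normcD. Qed.

Lemma normc_ge0 a : 0 <= Normc.normc a.
Proof. by case: a => u v; exact: sqrtr_ge0. Qed.

Lemma normc_sum (I : Type) (r : seq I) (P : pred I) (F : I -> R[i]) :
  Normc.normc (\sum_(i <- r | P i) F i) <= \sum_(i <- r | P i) Normc.normc (F i).
Proof.
elim/big_ind2 : _ => // [|a u b v au bv]; first by rewrite Normc.normc0.
by apply: le_trans (normcD _ _) _; exact: lerD.
Qed.

Lemma normc_Re a : `|complex.Re a| <= Normc.normc a.
Proof.
by case: a => u v /=; rewrite -sqrtr_sqr ler_wsqrtr// lerDl sqr_ge0.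
Qed.

Lemma normc_Im a : `|complex.Im a| <= Normc.normc a.
Proof.
by case: a => u v /=; rewrite -sqrtr_sqr ler_wsqrtr// lerDr sqr_ge0.
Qed.

Lemma normc_le_ReIm a : Normc.normc a <= `|complex.Re a| + `|complex.Im a|.
Proof.
case: a => u v /=; rewrite -[leRHS]ger0_norm ?addr_ge0// -sqrtr_sqr ler_wsqrtr//.
rewrite sqrrD !real_normK ?num_real// addrAC -[X in X <= _]addr0 lerD2l.
by rewrite mulrn_wge0// mulr_ge0.
Qed.

Lemma normc_expi x : Normc.normc (expi x) = 1.
Proof. by rewrite /Normc.normc /expi cos2Dsin2 sqrtr1. Qed.

Lemma expiD x y : expi (x + y) = expi x * expi y.
Proof.
by rewrite /expi cosD sinD; apply/eqP; rewrite eq_complex /= eqxx /= addrC (mulrC (sin x)) eqxx.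
Qed.

Lemma expi0 : expi 0 = 1 :> R[i].
Proof. by rewrite /expi cos0 sin0. Qed.

Lemma expiM x n : expi (n%:R * x) = expi x ^+ n.
Proof.
elim: n => [|n IH]; first by rewrite mul0r expi0 expr0.
by rewrite -natr1 mulrDl mul1r expiD IH exprSr.
Qed.

Lemma expi_intmul2pi (n : int) : expi (2 * pi * n%:~R) = 1 :> R[i].
Proof. by rewrite /expi cos_intmul2pi sin_intmul2pi. Qed.

Lemma expi_neq1 x : 0 < x < 1 -> expi (2 * pi * x) != 1.
Proof.
move=> /andP[x0 x1]; have p0 := pi_gt0 R; rewrite eq_complex negb_and /=.
apply/orP; left; rewrite (_ : 2 * pi * x = (pi * x) *+ 2); last by ring.
rewrite cos_mulr2n cos2sin2.
have : 0 < sin (pi * x) by apply: sin_gt0_pi; apply/andP; split; nra.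
by move=> s0; rewrite lt_eqF//; nra.
Qed.

(** A geometric sum whose ratio is an M-th root of unity, equal to 1 only if M
divides m. *)
Lemma sum_expi_roots (M : nat) (m : int) : (0 < M)%N ->
  \sum_(j < M) expi (j%:R * (2 * pi * (m%:~R / M%:R))) =
  if (M %| m)%Z then M%:R else 0 :> R[i].
Proof.
move=> M0; have M0' : M%:R != 0 :> R by rewrite pnatr_eq0 -lt0n.
have [/dvdzP[q ->]|nM] := boolP (M %| m)%Z.
  rewrite (eq_bigr (fun=> 1)) => [|j _]; first by rewrite sumr_const card_ord.
  by rewrite intrM mulfK// expiM expi_intmul2pi expr1n.
pose w : R[i] := expi (2 * pi * (m%:~R / M%:R)).
rewrite (eq_bigr (fun j : 'I_M => w ^+ j)) => [|j _]; last by rewrite expiM.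
have wM : w ^+ M = 1.
  by rewrite -expiM mulrCA (mulrC M%:R) divfK// expi_intmul2pi.
have w1 : w - 1 != 0.
  rewrite subr_eq0 /w.
  have -> : m%:~R / M%:R = (m %/ M)%Z%:~R + (m %% M)%Z%:~R / M%:R :> R.
    by rewrite {1}(divz_eq m M) intrD intrM mulrDl mulfK.
  rewrite mulrDr expiD expi_intmul2pi mul1r; apply: expi_neq1.
  have Mz : (M : int) != 0 by rewrite -lt0n.
  have r0 : 0 < (m %% M)%Z.
    by rewrite lt_neqAle modz_ge0// andbT eq_sym; apply: contra nM => /eqP /dvdz_mod0P.
  have rM : (m %% M)%Z < M by rewrite ltz_pmod.
  rewrite divr_gt0 ?ltr0z ?ltr0n//= ltr_pdivrMr ?ltr0n// mul1r.
  by rewrite -[M%:R]/(M%:~R) ltr_int.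
by apply: (mulfI w1); rewrite mulr0 -subrX1 wM subrr.
Qed.

End complex_exponential.

(** * Aliasing on a multiple rank-1 lattice *)

Section lattice_algorithm.
Context {R : realType} (d : nat).
Implicit Types (h k : 'rV[int]_d) (x : torus_pt R d) (g : torus_pt R d -> R[i]).

Definition character h x : R[i] := expi (2 * pi * dotp_real h x).

Lemma normc_character h x : Normc.normc (character h x) = 1.
Proof. exact: normc_expi. Qed.

Lemma character_mod1 h (y : 'I_d -> R) :
  character h (mod1 y) = expi (2 * pi * \sum_(i < d) (h 0 i)%:~R * y i).
Proof.
rewrite /character /dotp_real (eq_bigr (fun i =>
   (h 0 i)%:~R * y i + (- (h 0 i * Num.floor (y i)))%:~R)); last first.
  by move=> i _; rewrite tnth_mktuple mulrBr mulrNz intrM.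
rewrite big_split /= mulrDr expiD -[X in _ * expi (_ * X)]raddf_sum /=.
by rewrite expi_intmul2pi mulr1.
Qed.

Lemma character_lattice_point h z (M j : nat) :
  character h (lattice_point z M j) = expi (2 * pi * (j%:R * ((dotp h z)%:~R / M%:R))).
Proof.
rewrite character_mod1 /dotp raddf_sum /= mulr_suml mulr_sumr; congr expi; congr (_ * _).
by apply: eq_bigr => i _; rewrite intrM; ring.
Qed.

Variables (L : nat) (z : nat -> 'rV[int]_d) (Ms : nat -> nat).

(** Aliasing: on the lattice of z_l, the characters of h and k have the same samples
when h.z_l and k.z_l agree modulo M_l, and are orthogonal otherwise. *)
Lemma lattice_coef_character k l h : (0 < Ms l)%N ->
  lattice_coef z Ms (character k) l h =
  (dotp h (z l) == dotp k (z l) %[mod Ms l])%Z%:R.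
Proof.
move=> M0; rewrite /lattice_coef.
rewrite (eq_bigr (fun j : 'I_(Ms l) => expi (j%:R *
   (2 * pi * ((dotp k (z l) - dotp h (z l))%:~R / (Ms l)%:R))))); last first.
  move=> j _; rewrite character_lattice_point -expiD intrB; congr expi; ring.
rewrite sum_expi_roots// eq_sym eqz_mod_dvd.
case: ifP => _; last by rewrite mulr0.
by rewrite mulVf// pnatr_eq0 -lt0n.
Qed.

Lemma lattice_coef_sum (F : seq 'rV[int]_d) (c : 'rV[int]_d -> R[i]) l h :
  lattice_coef z Ms (fun x => \sum_(k <- F) c k * character k x) l h =
  \sum_(k <- F) c k * lattice_coef z Ms (character k) l h.
Proof.
rewrite /lattice_coef (eq_bigr (fun k => \sum_(j < Ms l) c k * ((Ms l)%:R^-1 *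
  (character k (lattice_point (z l) (Ms l) j) *
    expi (- (2 * pi * j%:R * (dotp h (z l))%:~R / (Ms l)%:R)))))); last first.
  by move=> k _; rewrite !mulr_sumr.
rewrite exchange_big /= mulr_sumr; apply: eq_bigr => j _.
rewrite mulr_suml mulr_sumr; apply: eq_bigr => k _; ring.
Qed.

Lemma normc_lattice_coefB g1 g2 (e : R) l h : (0 < Ms l)%N ->
  (forall j, Normc.normc (g1 (lattice_point (z l) (Ms l) j) -
                          g2 (lattice_point (z l) (Ms l) j)) <= e) ->
  Normc.normc (lattice_coef z Ms g1 l h - lattice_coef z Ms g2 l h) <= e.
Proof.
move=> M0 ge; rewrite /lattice_coef -mulrBr -sumrB Normc.normcM.
have M0' : 0 < (Ms l)%:R :> R by rewrite ltr0n.
have -> : Normc.normc ((Ms l)%:R^-1 : R[i]) = (Ms l)%:R^-1.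
  rewrite Normc.normcV (_ : (Ms l)%:R = ((Ms l)%:R)%:C%C); last by rewrite rmorph_nat.
  by rewrite /Normc.normc /= expr0n /= addr0 sqrtr_sqr ger0_norm.
rewrite ler_pdivrMl//; apply: le_trans (normc_sum _ _ _) _.
rewrite (_ : _ * e = \sum_(j < Ms l) e); last by rewrite sumr_const card_ord mulr_natl.
by apply: ler_sum => j _; rewrite -mulrBl Normc.normcM normc_expi mulr1.
Qed.

(** The algorithm as a linear operator on point values; [lattice_approx] is its
value at the continuous representative. *)
Definition lattice_op (I : set 'rV[int]_d) g x : R[i] :=
  \sum_(l < L) \sum_(h \in freqs z Ms I l) lattice_coef z Ms g l h * character h x.

Lemma used_freqs_mono I l l' : (l <= l')%N ->
  used_freqs z Ms I l `<=` used_freqs z Ms I l'.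
Proof.
elim: l' => [|l' IH]; first by rewrite leqn0 => /eqP ->.
rewrite leq_eqVlt => /predU1P[->//|]; rewrite ltnS => /IH h.
by apply: (subset_trans h) => k hk; left.
Qed.

Lemma freqs_disjoint I l l' h : freqs z Ms I l h -> freqs z Ms I l' h -> l = l'.
Proof.
wlog ll' : l l' / (l <= l')%N.
  by move=> H; case: (leqP l l') => [/H//|/ltnW /H ll' a b]; apply/esym/ll'.
move: ll'; rewrite leq_eqVlt => /predU1P[//|ll'] hl [[_ nU] _]; case: nU.
by apply: used_freqs_mono ll' _ _; right.
Qed.

Lemma freqs_sub I l : freqs z Ms I l `<=` I.
Proof. by move=> h [[]]. Qed.

Lemma freqs_alias I l h k : freqs z Ms I l h -> I k ->
  (dotp h (z l) == dotp k (z l) %[mod Ms l])%Z -> h = k.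
Proof.
move=> [_ hI] Ik; apply: contraTeq => hk; apply: hI; split => //= kh.
by rewrite kh eqxx in hk.
Qed.

Lemma lattice_op_sum I (F : seq 'rV[int]_d) (c : 'rV[int]_d -> R[i]) x :
  finite_set I ->
  lattice_op I (fun x => \sum_(k <- F) c k * character k x) x =
  \sum_(k <- F) c k * lattice_op I (character k) x.
Proof.
move=> fI; rewrite /lattice_op (eq_bigr (fun k => \sum_(l < L)
   c k * \sum_(h \in freqs z Ms I l) lattice_coef z Ms (character k) l h * character h x));
  last by move=> k _; rewrite mulr_sumr.
rewrite exchange_big /=; apply: eq_bigr => l _.
have fl : finite_set (freqs z Ms I l) by apply: sub_finite_set fI; exact: freqs_sub.
rewrite fsbig_finite//= (eq_bigr (fun h => \sum_(k <- F)
   c k * (lattice_coef z Ms (character k) l h * character h x))); last first.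
  by move=> h _; rewrite lattice_coef_sum mulr_suml; apply: eq_bigr => k _; rewrite mulrA.
rewrite exchange_big /=; apply: eq_bigr => k _.
by rewrite fsbig_finite//= mulr_sumr.
Qed.

Hypothesis Ms_gt0 : forall l, (l < L)%N -> (0 < Ms l)%N.

(** Within I, the only alias on lattice l of a frequency computed there is itself,
and k is computed on exactly one lattice. *)
Lemma lattice_op_in I k x : I = \bigcup_(l in `I_L) freqs z Ms I l -> I k ->
  lattice_op I (character k) x = character k x.
Proof.
move=> IE Ik; have : (\bigcup_(l in `I_L) freqs z Ms I l) k by rewrite -IE.
move=> [l /= lL kl]; rewrite /lattice_op (bigD1 (Ordinal lL))//= [X in _ + X]big1 ?addr0.
  rewrite -(@fsbig_widen _ _ _ _ [set k]) => [|h ->//|h [hl /= hk]].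
    by rewrite fsbig_set1 lattice_coef_character ?Ms_gt0// eqxx mul1r.
  rewrite lattice_coef_character ?Ms_gt0//.
  by have [/(freqs_alias hl Ik)/hk//|_] := boolP (_ == _ %[mod _])%Z; rewrite mul0r.
move=> l' ll'; apply: fsbig1 => h hl'.
rewrite lattice_coef_character ?Ms_gt0//.
have [/(freqs_alias hl' Ik) hk|_] := boolP (_ == _ %[mod _])%Z; last by rewrite mul0r.
move: ll'; rewrite -val_eqE /= => /eqP; case.
by apply: (@freqs_disjoint I _ _ k) => //; rewrite -hk.
Qed.

Lemma sum_atmost1 (T : eqType) (s : seq T) (P : pred T) : uniq s ->
  (forall a b, a \in s -> b \in s -> P a -> P b -> a = b) ->
  \sum_(a <- s) (P a)%:R <= 1 :> R.
Proof.
move=> us sP; have [/hasP[a sa Pa]|/hasPn nP] := boolP (has P s).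
  rewrite (bigD1_seq a)//= Pa big_seq_cond big1 ?addr0// => b /andP[sb ba].
  by case: (boolP (P b)) => // Pb; rewrite (sP b a)// eqxx in ba.
by rewrite big_seq big1// => a /nP /negPf ->.
Qed.

(** Two frequencies computed on the same lattice that are both aliases of k are
aliases of each other, hence equal; so each lattice contributes at most one
character. *)
Lemma normc_lattice_op_notin I k x : finite_set I ->
  Normc.normc (lattice_op I (character k) x) <= L%:R.
Proof.
move=> fI; apply: le_trans (normc_sum _ _ _) _.
rewrite [leRHS](_ : _ = \sum_(l < L) 1); last by rewrite sumr_const card_ord.
apply: ler_sum => l _.
have fl : finite_set (freqs z Ms I l) by apply: sub_finite_set fI; exact: freqs_sub.
rewrite fsbig_finite//=; apply: le_trans (normc_sum _ _ _) _.
rewrite (eq_bigr (fun h => (dotp h (z l) == dotp k (z l) %[mod Ms l])%Z%:R)); last first.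
  move=> h _; rewrite Normc.normcM normc_character mulr1 lattice_coef_character ?Ms_gt0//.
  by case: (_ == _); rewrite ?Normc.normc1 ?Normc.normc0.
apply: sum_atmost1; first exact: fset_uniq.
move=> a b; rewrite !in_fset_set// !inE => al bl /eqP ak /eqP bk.
apply: (freqs_alias al); first exact: freqs_sub bl.
by rewrite ak bk.
Qed.

(** The algorithm is linear and exact on the characters of I, so that only the
frequencies outside I contribute, each with a factor at most 1 + L. *)
Lemma lattice_error_polynomial I (F : seq 'rV[int]_d) (c : 'rV[int]_d -> R[i]) x :
  finite_set I -> I = \bigcup_(l in `I_L) freqs z Ms I l ->
  Normc.normc (\sum_(k <- F) c k * character k x -
     lattice_op I (fun x => \sum_(k <- F) c k * character k x) x) <=
  (1 + L%:R) * \sum_(k <- F | k \notin I) Normc.normc (c k).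
Proof.
move=> fI IE; rewrite lattice_op_sum// -sumrB (bigID (fun k => k \in I)) /=.
rewrite [X in X + _]big1 ?add0r => [|k]; last first.
  by rewrite inE => Ik; rewrite lattice_op_in// subrr.
rewrite mulr_sumr; apply: le_trans (normc_sum _ _ _) _; apply: ler_sum => k _.
rewrite -mulrBr Normc.normcM mulrC ler_wpM2r ?normc_ge0//.
apply: le_trans (normcB _ _) _; rewrite normc_character lerD2l.
exact: normc_lattice_op_notin.
Qed.

Lemma lattice_op_close I g1 g2 (e : R) x : finite_set I ->
  (forall l j, Normc.normc (g1 (lattice_point (z l) (Ms l) j) -
                          g2 (lattice_point (z l) (Ms l) j)) <= e) ->
  Normc.normc (lattice_op I g1 x - lattice_op I g2 x) <=
  (\sum_(l < L) #|` fset_set (freqs z Ms I l)|%fset)%:R * e.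
Proof.
move=> fI ge; rewrite /lattice_op -sumrB natr_sum mulr_suml.
apply: le_trans (normc_sum _ _ _) _; apply: ler_sum => l _.
have fl : finite_set (freqs z Ms I l) by apply: sub_finite_set fI; exact: freqs_sub.
rewrite !fsbig_finite//= -sumrB; apply: le_trans (normc_sum _ _ _) _.
rewrite -[X in X%:R]sum1_size natr_sum mulr_suml; apply: ler_sum => h _.
rewrite mul1r -mulrBl Normc.normcM normc_character mulr1.
by apply: normc_lattice_coefB; rewrite ?Ms_gt0.
Qed.

End lattice_algorithm.

(** * Fourier coefficients *)

Section torus_integral.
Context {R : realType} (d : nat).
Implicit Types (f g : torus_pt R d -> R[i]) (h k : 'rV[int]_d) (c : R[i]).

Lemma L1D f g : L1 f -> L1 g -> L1 (fun x => f x + g x).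
Proof.
move=> [f1 f2] [g1 g2]; split.
  apply: eq_integrable (integrableD measurableT f1 g1) => // x _ /=.
  by rewrite -EFinD; case: (f x) => ? ?; case: (g x).
apply: eq_integrable (integrableD measurableT f2 g2) => // x _ /=.
by rewrite -EFinD; case: (f x) => ? ?; case: (g x).
Qed.

Lemma ReM (a b : R[i]) : complex.Re (a * b) =
  complex.Re a * complex.Re b - complex.Im a * complex.Im b.
Proof. by case: a => ? ?; case: b. Qed.

Lemma ImM (a b : R[i]) : complex.Im (a * b) =
  complex.Re a * complex.Im b + complex.Im a * complex.Re b.
Proof. by case: a => ? ?; case: b. Qed.

Lemma L1M f (b : torus_pt R d -> R[i]) : L1 f ->
  bounded_measurable (fun x => complex.Re (b x)) ->
  bounded_measurable (fun x => complex.Im (b x)) -> L1 (fun x => f x * b x).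
Proof.
move=> [f1 f2] b1 b2; split.
  have := integrableB measurableT (integrable_mul_bounded f1 b1) (integrable_mul_bounded f2 b2).
  by apply: eq_integrable => // x _ /=; rewrite ReM EFinB.
have := integrableD measurableT (integrable_mul_bounded f1 b2) (integrable_mul_bounded f2 b1).
by apply: eq_integrable => // x _ /=; rewrite ImM EFinD.
Qed.

Lemma L1Z c f : L1 f -> L1 (fun x => c * f x).
Proof.
move=> Lf; under eq_fun do rewrite mulrC.
by apply: L1M => //; exact: bounded_measurable_cst.
Qed.

Lemma torus_integralD f g : L1 f -> L1 g ->
  torus_integral (fun x => f x + g x) = torus_integral f + torus_integral g.
Proof.
move=> [f1 f2] [g1 g2]; rewrite /torus_integral; apply/eqP; rewrite eq_complex /=.
apply/andP; split; apply/eqP.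
  by rewrite -RintegralD//; apply: eq_Rintegral => x _; case: (f x) => ? ?; case: (g x).
by rewrite -RintegralD//; apply: eq_Rintegral => x _; case: (f x) => ? ?; case: (g x).
Qed.

Lemma torus_integralZ c f : L1 f ->
  torus_integral (fun x => c * f x) = c * torus_integral f.
Proof.
move=> [f1 f2].
have E (a b : R) : L1 f ->
    Rintegral (torus_measure d) setT (fun x => a * complex.Re (f x) + b * complex.Im (f x)) =
    a * Rintegral (torus_measure d) setT (fun x => complex.Re (f x)) +
    b * Rintegral (torus_measure d) setT (fun x => complex.Im (f x)).
  move=> _; rewrite RintegralD ?RintegralZl//.
    by apply: eq_integrable (integrableZl measurableT a f1) => // x _ /=; rewrite EFinM.
  by apply: eq_integrable (integrableZl measurableT b f2) => // x _ /=; rewrite EFinM.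
rewrite /torus_integral; apply/eqP; rewrite eq_complex ReM ImM /=.
apply/andP; split; apply/eqP.
  by rewrite -mulNr -E//; apply: eq_Rintegral => x _; rewrite ReM mulNr.
by rewrite addrC -E//; apply: eq_Rintegral => x _; rewrite ImM addrC.
Qed.

Lemma L1_0 : @L1 R d (fun=> 0).
Proof. by split; exact: integrable0. Qed.

Lemma L1_sum (I : Type) (s : seq I) (F : I -> torus_pt R d -> R[i]) :
  (forall i, L1 (F i)) -> L1 (fun x => \sum_(i <- s) F i x).
Proof.
move=> LF; elim: s => [|i s IH].
  by under eq_fun do rewrite big_nil; exact: L1_0.
by under eq_fun do rewrite big_cons; exact: L1D.
Qed.

Lemma torus_integral_sum (I : Type) (s : seq I) (F : I -> torus_pt R d -> R[i]) :
  (forall i, L1 (F i)) ->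
  torus_integral (fun x => \sum_(i <- s) F i x) = \sum_(i <- s) torus_integral (F i).
Proof.
move=> LF; elim: s => [|i s IH].
  under eq_fun do rewrite big_nil; rewrite big_nil /torus_integral /=.
  by rewrite (Rintegral_probability_cst (torus_measure d)).
under eq_fun do rewrite big_cons; rewrite big_cons torus_integralD ?IH//.
exact: L1_sum.
Qed.

Lemma L1_bounded f : bounded_measurable (fun x => complex.Re (f x)) ->
  bounded_measurable (fun x => complex.Im (f x)) -> L1 f.
Proof.
by move=> b1 b2; split; exact: (integrable_bounded_measurable (torus_measure d)).
Qed.

Lemma L1_character h : L1 (@character R d h).
Proof.
apply: L1_bounded; apply: bounded_measurable_trigpoly.
  exact: trigpoly_cos.
exact: trigpoly_sin.
Qed.

Lemma torus_integral_characterE h :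
  torus_integral (@character R d h) = (h == 0)%:R.
Proof.
have [C S] := @torus_integral_character R d h.
by rewrite /torus_integral /character /= C S; case: (h == 0).
Qed.

Lemma characterB h k (x : torus_pt R d) :
  character (k - h) x = character k x * expi (- (2 * pi * dotp_real h x)).
Proof. by rewrite /character dotp_realBl mulrBr expiD. Qed.

(** The factor 2 comes from estimating the real and imaginary parts separately. *)
Lemma normc_torus_integral f (e : R) : L1 f ->
  (forall x, Normc.normc (f x) <= e) -> Normc.normc (torus_integral f) <= 2 * e.
Proof.
move=> [f1 f2] fe.
have H (u : torus_pt R d -> R) : (torus_measure d).-integrable setT (EFin \o u) ->
    (forall x, `|u x| <= e) -> `|Rintegral (torus_measure d) setT u| <= e.
  move=> iu ue; apply: le_trans (le_normr_Rintegral _ iu) _ => //.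
  rewrite -[leRHS](Rintegral_probability_cst (torus_measure d) e).
  apply: le_Rintegral => //.
  - exact: integrable_norm.
  - exact: (integrable_bounded_measurable (torus_measure d) (bounded_measurable_cst _ e)).
apply: le_trans (normc_le_ReIm _) _; rewrite /torus_integral /= mulr_natl mulr2n lerD//.
  by apply: H => // x; apply: le_trans (normc_Re _) (fe x).
by apply: H => // x; apply: le_trans (normc_Im _) (fe x).
Qed.

Lemma L1_fourier f h : L1 f -> L1 (fun x => f x * expi (- (2 * pi * dotp_real h x))).
Proof.
move=> Lf; apply: L1M => //; apply: bounded_measurable_trigpoly => /=.
  by under eq_fun do rewrite cosN; exact: trigpoly_cos.
under eq_fun do rewrite sinN -mulN1r; apply: trigpolyZ; exact: trigpoly_sin.
Qed.

Lemma fourier_coefB f g h : L1 f -> L1 g ->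
  fourier_coef (fun x => f x - g x) h = fourier_coef f h - fourier_coef g h.
Proof.
move=> Lf Lg; rewrite /fourier_coef.
under eq_fun do rewrite mulrBl -mulN1r.
rewrite torus_integralD; [|exact: L1_fourier|by apply: L1Z; exact: L1_fourier].
by rewrite torus_integralZ ?mulN1r//; exact: L1_fourier.
Qed.

Lemma fourier_coef_sum (F : seq 'rV[int]_d) (c : 'rV[int]_d -> R[i]) h : uniq F ->
  fourier_coef (fun x => \sum_(k <- F) c k * character k x) h =
  if h \in F then c h else 0.
Proof.
move=> uF; rewrite /fourier_coef.
under eq_fun do (rewrite mulr_suml; under eq_bigr do rewrite -mulrA -characterB).
rewrite torus_integral_sum; last by move=> k; apply: L1Z; exact: L1_character.
rewrite (eq_bigr (fun k => if k == h then c h else 0)); last first.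
  move=> k _; rewrite torus_integralZ; last exact: L1_character.
  rewrite torus_integral_characterE subr_eq0.
  by case: eqP => [->|_]; rewrite ?mulr1 ?mulr0.
rewrite -big_mkcond /=; case: ifPn => hF; last first.
  by rewrite big_seq_cond big1// => k /andP[kF /eqP kh]; rewrite kh (negPf hF) in kF.
by rewrite big_mkcond (bigD1_seq h)//= eqxx big1 ?addr0// => k /negPf ->.
Qed.

(** Comparing the coefficients at h and -h separates the cosine and sine integrals
of the real and imaginary parts, so that all four vanish. *)
Lemma fourier_coef_inj f : L1 f -> (forall h, fourier_coef f h = 0) ->
  {ae torus_measure d, forall x, f x = 0}.
Proof.
move=> Lf f0; have [f1 f2] := Lf.
have bc h := bounded_measurable_trigpoly (@trigpoly_cos R d h).
have bs h := bounded_measurable_trigpoly (@trigpoly_sin R d h).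
pose C u h := Rintegral (torus_measure d) setT
  (fun x : torus_pt R d => u x * cos (2 * pi * dotp_real h x)).
pose S u h := Rintegral (torus_measure d) setT
  (fun x : torus_pt R d => u x * sin (2 * pi * dotp_real h x)).
pose u x := complex.Re (f x); pose v x := complex.Im (f x).
have E1 h : C u h + S v h = 0.
  have /(congr1 (@complex.Re R)) := f0 h; rewrite /fourier_coef /torus_integral /= => <-.
  rewrite /C /S -RintegralD//; try exact: integrable_mul_bounded.
  by apply: eq_Rintegral => x _; rewrite ReM /= cosN sinN mulrN opprK.
have E2 h : C v h - S u h = 0.
  have /(congr1 (@complex.Im R)) := f0 h; rewrite /fourier_coef /torus_integral /= => <-.
  rewrite /C /S -RintegralB//; try exact: integrable_mul_bounded.
  by apply: eq_Rintegral => x _; rewrite ImM /= cosN sinN mulrN addrC.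
have CN w h : C w (- h) = C w h.
  by apply: eq_Rintegral => x _; rewrite dotp_realNl mulrN cosN.
have SN w h : (torus_measure d).-integrable setT (EFin \o w) -> S w (- h) = - S w h.
  move=> iw; rewrite -mulN1r -RintegralZl//; last exact: integrable_mul_bounded.
  by apply: eq_Rintegral => x _; rewrite dotp_realNl mulrN sinN mulrN mulN1r.
have H h : [/\ C u h = 0, S u h = 0, C v h = 0 & S v h = 0].
  have := E1 h; have := E1 (- h); have := E2 h; have := E2 (- h).
  by rewrite !CN !SN// => *; split; lra.
have u0 : {ae torus_measure d, forall x, u x = 0}.
  by apply: fourier_uniqueness => // h; have [] := H h.
have v0 : {ae torus_measure d, forall x, v x = 0}.
  by apply: fourier_uniqueness => // h; have [] := H h.
by apply: filterS2 u0 v0 => x; rewrite /u /v; case: (f x) => a b /= -> ->.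
Qed.

End torus_integral.

(** * Uniformly convergent trigonometric sums *)

Lemma cvg_of_rate (R : realType) (u e : nat -> R) :
  (forall m n, (m <= n)%N -> `|u n - u m| <= e m) -> e @ \oo --> (0 : R) ->
  cvgn u /\ forall m, `|limn u - u m| <= e m.
Proof.
move=> ue e0.
have cu : cvgn u.
  apply: cauchy_cvg; apply: cauchy_exP => _/posnumP[eps].
  have /cvgrPdist_lt /(_ eps%:num (gt0 _)) [m _ me] := e0.
  exists (u m); exists m => // n /= mn; rewrite -ball_normE /= distrC.
  apply: le_lt_trans (ue _ _ mn) _; have := me m (leqnn m).
  by rewrite sub0r normrN; apply: le_lt_trans; exact: ler_norm.
split => // m.
have : (fun n => `|u n - u m|) @ \oo --> `|limn u - u m|.
  by apply: cvg_norm; apply: cvgB; [exact: cu|exact: cvg_cst].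
apply: (@closed_cvg _ _ _ _ _ (fun y => y <= e m)); first exact: closed_le.
by exists m => // n /= mn; exact: ue.
Qed.

Lemma continuous_uniform_limit (R : realType) (T : topologicalType) (g : T -> R) :
  (forall eps : R, 0 < eps -> exists f : T -> R,
     continuous f /\ forall y, `|g y - f y| <= eps) -> continuous g.
Proof.
move=> H x; apply/cvgrPdist_le => _/posnumP[eps].
have e3 : 0 < eps%:num / 3 :> R by rewrite divr_gt0.
have [f [cf gf]] := H _ e3.
have /cvgrPdist_le /(_ _ e3) := cf x.
apply: filterS => y fxy.
rewrite (_ : g x - g y = (g x - f x) + (f x - f y) - (g y - f y)); last by ring.
apply: le_trans (ler_normB _ _) _; apply: le_trans (lerD (ler_normD _ _) (lexx _)) _.
have := gf x; have := gf y; move: fxy => /=; lra.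
Qed.

Lemma continuous_sumr (R : realType) (T : topologicalType) (I : Type) (s : seq I)
    (F : I -> T -> R) :
  (forall i, continuous (F i)) -> continuous (fun x => \sum_(i <- s) F i x).
Proof.
move=> cF; elim: s => [|i s IH] x.
  by under eq_fun do rewrite big_nil; exact: cst_continuous.
under eq_fun do rewrite big_cons.
exact: (@continuousD _ _ _ (F i) (fun y => \sum_(j <- s) F j y) x (cF i x) (IH x)).
Qed.

Section uniform_sum.
Context {R : realType} (d : nat).
Variables (F : nat -> seq 'rV[int]_d) (c : 'rV[int]_d -> R[i]) (e : nat -> R).
Let P n (x : torus_pt R d) := \sum_(k <- F n) c k * character k x.
Hypothesis Pe : forall m n x, (m <= n)%N -> Normc.normc (P n x - P m x) <= e m.
Hypothesis e0 : e @ \oo --> (0 : R).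

Definition uniform_sum (x : torus_pt R d) : R[i] :=
  (limn (fun n => complex.Re (P n x)) +i* limn (fun n => complex.Im (P n x)))%C.

Let Re_rate x : cvgn (fun n => complex.Re (P n x)) /\
  forall m, `|complex.Re (uniform_sum x) - complex.Re (P m x)| <= e m.
Proof.
apply: cvg_of_rate => // m n mn; apply: le_trans (Pe x mn).
by rewrite -raddfB; exact: normc_Re.
Qed.

Let Im_rate x : cvgn (fun n => complex.Im (P n x)) /\
  forall m, `|complex.Im (uniform_sum x) - complex.Im (P m x)| <= e m.
Proof.
apply: cvg_of_rate => // m n mn; apply: le_trans (Pe x mn).
by rewrite -raddfB; exact: normc_Im.
Qed.

Lemma uniform_sum_close n x : Normc.normc (uniform_sum x - P n x) <= 2 * e n.
Proof.
apply: le_trans (normc_le_ReIm _) _; rewrite !raddfB mulr_natl mulr2n lerD//.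
  exact: (Re_rate x).2.
exact: (Im_rate x).2.
Qed.

Lemma trigpoly_sum (s : seq 'rV[int]_d) (a b : 'rV[int]_d -> R) :
  trigpoly (fun x => \sum_(k <- s) (a k * cos (2 * pi * dotp_real k x) +
    b k * sin (2 * pi * dotp_real k x)) : R).
Proof.
elim: s => [|k s IH].
  by under eq_fun do rewrite big_nil; exact: trigpoly_cst.
under eq_fun do rewrite big_cons; apply: trigpolyD => //.
by apply: trigpolyD; apply: trigpolyZ; [exact: trigpoly_cos|exact: trigpoly_sin].
Qed.

Lemma trigpoly_Re_sum n : trigpoly (fun x => complex.Re (P n x)).
Proof.
under eq_fun => x.
  rewrite /P raddf_sum.
  under eq_bigr => k _ do rewrite /= (ReM (c k)) /= -mulNr.
  over.
exact: (@trigpoly_sum _ (fun k => complex.Re (c k)) (fun k => - complex.Im (c k))).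
Qed.

Lemma trigpoly_Im_sum n : trigpoly (fun x => complex.Im (P n x)).
Proof.
under eq_fun => x.
  rewrite /P raddf_sum.
  under eq_bigr => k _ do rewrite /= (ImM (c k)) /= addrC.
  over.
exact: (@trigpoly_sum _ (fun k => complex.Im (c k)) (fun k => complex.Re (c k))).
Qed.

Let bounded_measurable_limit (p : nat -> torus_pt R d -> R) (q : torus_pt R d -> R) :
  (forall n, trigpoly (p n)) -> (forall x, cvgn (p ^~ x)) -> (forall x, q x = limn (p ^~ x)) ->
  (forall n x, `|q x - p n x| <= e n) -> bounded_measurable q.
Proof.
move=> tp cp qE qp; split.
  apply: (@measurable_fun_cvg _ _ _ _ p) => [n|x _]; first exact: measurable_trigpoly.
  by rewrite qE; exact: cp.
have [B Bp] := bounded_trigpoly (tp 0).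
exists (e 0 + B) => x; rewrite -(subrK (p 0%N x) (q x)).
by apply: le_trans (ler_normD _ _) _; rewrite lerD.
Qed.

Lemma bounded_measurable_Re_uniform_sum :
  bounded_measurable (fun x => complex.Re (uniform_sum x)).
Proof.
apply: (@bounded_measurable_limit (fun n x => complex.Re (P n x))) => //.
- exact: trigpoly_Re_sum.
- by move=> x; exact: (Re_rate x).1.
- by move=> n x; exact: (Re_rate x).2.
Qed.

Lemma bounded_measurable_Im_uniform_sum :
  bounded_measurable (fun x => complex.Im (uniform_sum x)).
Proof.
apply: (@bounded_measurable_limit (fun n x => complex.Im (P n x))) => //.
- exact: trigpoly_Im_sum.
- by move=> x; exact: (Im_rate x).1.
- by move=> n x; exact: (Im_rate x).2.
Qed.

Lemma L1_uniform_sum : L1 uniform_sum.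
Proof.
exact: L1_bounded bounded_measurable_Re_uniform_sum bounded_measurable_Im_uniform_sum.
Qed.

Let continuous_trig_mod1 (s : seq 'rV[int]_d) (a b : 'rV[int]_d -> R) :
  continuous (fun y : 'rV[R]_d => \sum_(k <- s)
     (a k * cos (2 * pi * \sum_(i < d) (k 0 i)%:~R * y 0 i) +
      b k * sin (2 * pi * \sum_(i < d) (k 0 i)%:~R * y 0 i)) : R).
Proof.
have cl (k : 'rV[int]_d) : continuous (fun y : 'rV[R]_d =>
    2 * pi * \sum_(i < d) (k 0 i)%:~R * y 0 i : R).
  move=> y; apply: (@continuousM R _ (fun=> 2 * pi)
    (fun y : 'rV[R]_d => \sum_(i < d) (k 0 i)%:~R * y 0 i)); first exact: cst_continuous.
  apply: continuous_sumr => i {}y.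
  apply: (@continuousM R _ (fun=> (k 0 i)%:~R) (fun y : 'rV[R]_d => y 0 i)).
    exact: cst_continuous.
  exact: coord_continuous.
apply: continuous_sumr => k y.
apply: (@continuousD _ _ _ (fun y : 'rV[R]_d => a k * cos (2 * pi * \sum_(i < d) (k 0 i)%:~R * y 0 i))
  (fun y : 'rV[R]_d => b k * sin (2 * pi * \sum_(i < d) (k 0 i)%:~R * y 0 i))).
  apply: (@continuousM R _ (fun=> a k)); first exact: cst_continuous.
  by apply: continuous_comp; [exact: cl|exact: continuous_cos].
apply: (@continuousM R _ (fun=> b k)); first exact: cst_continuous.
by apply: continuous_comp; [exact: cl|exact: continuous_sin].
Qed.

Lemma torus_continuous_uniform_sum : torus_continuous uniform_sum.
Proof.
have e0' eps : 0 < eps -> exists n, e n <= eps.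
  move=> eps0; have /cvgrPdist_le /(_ eps eps0) [m _ me] := e0.
  exists m; have := me m (leqnn m); rewrite sub0r normrN; apply: le_trans.
  exact: ler_norm.
split; apply: continuous_uniform_limit => eps /e0' [n en].
  exists (fun y : 'rV[R]_d => complex.Re (P n (mod1 (y 0)))); split; last first.
    by move=> y; apply: le_trans en; exact: (Re_rate _).2.
  under eq_fun => y.
    rewrite /P raddf_sum.
    under eq_bigr => k _ do rewrite /= (ReM (c k)) character_mod1 /= -mulNr.
    over.
  exact: (@continuous_trig_mod1 _ (fun k => complex.Re (c k)) (fun k => - complex.Im (c k))).
exists (fun y : 'rV[R]_d => complex.Im (P n (mod1 (y 0)))); split; last first.
  by move=> y; apply: le_trans en; exact: (Im_rate _).2.
under eq_fun => y.
  rewrite /P raddf_sum.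
  under eq_bigr => k _ do rewrite /= (ImM (c k)) character_mod1 /= addrC.
  over.
exact: (@continuous_trig_mod1 _ (fun k => complex.Im (c k)) (fun k => complex.Re (c k))).
Qed.

Hypothesis F_uniq : forall n, uniq (F n).
Hypothesis F_exhaust : forall k, \forall n \near \oo, k \in F n.

(** The coefficient at h of the n-th partial sum is c h as soon as h lies in F n, and
it differs from that of the sum by at most 4 e(n). *)
Lemma fourier_coef_uniform_sum h : fourier_coef uniform_sum h = c h.
Proof.
have LP n : L1 (P n).
  by apply: L1_sum => k; apply: L1Z; exact: L1_character.
apply/eqP; rewrite -subr_eq0; apply/eqP/Normc.eq0_normc/eqP.
rewrite eq_le normc_ge0 andbT.
have e4 : (fun n => 4 * e n) @ \oo --> (0 : R).
  by rewrite -[X in _ --> X](mulr0 (4 : R)); apply: cvgM => //; exact: cvg_cst.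
apply: (@closed_cvg _ _ \oo _ (fun n => 4 * e n)
  (fun y => Normc.normc (fourier_coef uniform_sum h - c h) <= y)); last exact: e4.
  exact: closed_ge.
near=> n; have hn : h \in F n by near: n; exact: F_exhaust.
have -> : c h = fourier_coef (P n) h by rewrite /P fourier_coef_sum// hn.
rewrite -fourier_coefB//; last exact: L1_uniform_sum.
rewrite (_ : 4 = 2 * 2); last by ring.
rewrite -mulrA; apply: normc_torus_integral.
  apply: L1_fourier; rewrite (_ : (fun _ => _) = fun x => uniform_sum x + (-1) * P n x).
    by apply: L1D; [exact: L1_uniform_sum|exact: L1Z].
  by apply/funext => x; rewrite mulN1r.
by move=> x; rewrite Normc.normcM normc_expi mulr1; exact: uniform_sum_close.
Unshelve. all: by end_near. Qed.

Lemma ae_eq_uniform_sum f : L1 f -> (forall h, fourier_coef f h = c h) ->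
  {ae torus_measure d, forall x, f x = uniform_sum x}.
Proof.
move=> Lf fc.
have : {ae torus_measure d, forall x, f x - uniform_sum x = 0}.
  apply: fourier_coef_inj.
    rewrite (_ : (fun _ => _) = fun x => f x + (-1) * uniform_sum x).
      by apply: L1D => //; apply: L1Z; exact: L1_uniform_sum.
    by apply/funext => x; rewrite mulN1r.
  move=> h; rewrite fourier_coefB//; last exact: L1_uniform_sum.
  by rewrite fc fourier_coef_uniform_sum subrr.
by apply: filterS => x /eqP; rewrite subr_eq0 => /eqP.
Qed.

End uniform_sum.

(** * Continuous representatives *)

Section continuous_representative.
Context {R : realType} (d : nat).
Implicit Types (x : torus_pt R d).

Lemma mod1_cube (y : 'I_d -> R) : torus_cube (mod1 y).
Proof.
move=> i /=; rewrite in_itv /= tnth_mktuple subr_ge0 floor_le_tmp /= ltrBlDl.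
by have := floorD1_gt (y i); rewrite intrD.
Qed.

Lemma mod1_id x : torus_cube x -> mod1 (tnth x) = x.
Proof.
move=> cx; apply: eq_from_tnth => i; rewrite tnth_mktuple.
have := cx i; rewrite /= in_itv /= => /andP[x0 x1].
by rewrite (@floor_def _ _ 0) ?subr0//= x0.
Qed.

(** A nonzero value at x persists on a box of positive measure.  The box is taken
half-open with lower corner x, so that it stays inside the cube even when some
coordinates of x are 0. *)
Lemma continuous_ae0 (w : torus_pt R d -> R) :
  continuous (fun y : 'rV[R]_d => w (mod1 (y 0))) ->
  {ae torus_measure d, forall x, w x = 0} -> forall x, torus_cube x -> w x = 0.
Proof.
move=> cw w0 x cx; apply/eqP; apply: contrapT => /negP wx.
pose y0 : 'rV[R]_d := \row_i tnth x i.
have modrow p : torus_cube p -> mod1 ((\row_i tnth p i : 'rV[R]_d) 0) = p.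
  move=> cp; rewrite -[RHS](mod1_id cp); congr mod1.
  by apply/funext => i; rewrite mxE.
have : nbhs y0 [set y : 'rV[R]_d | w (mod1 (y 0)) != 0].
  have := cw y0; move=> /cvgrPdist_lt /(_ `|w x|); rewrite normr_gt0 => /(_ wx).
  apply: filterS => y; rewrite modrow//; apply: contraTneq => ->.
  by rewrite subr0 ltxx.
move=> /nbhs_ballP[_/posnumP[eps] yeps].
pose b i := Num.min 1 (tnth x i + eps%:num).
have x01 i : 0 <= tnth x i < 1 by have := cx i; rewrite /= in_itv.
have := @torus_measure_box_gt0 R d (tnth x) b.
have -> : torus_measure d [set p | forall i, `[tnth x i, b i[%classic (tnth p i)] = 0.
  apply: measure_negligible.
    exact: (@measurable_box R d (fun i => `[tnth x i, b i[%classic)).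
  apply: negligibleS w0 => p /= bp.
  have cp : torus_cube p.
    move=> i; have := bp i; rewrite /= !in_itv /= lt_min => /andP[xp /andP[-> _]].
    by rewrite andbT (le_trans _ xp)//; have /andP[] := x01 i.
  rewrite -(modrow p cp); apply/eqP; apply: yeps; split => // i j.
  rewrite ord1 !mxE -ball_normE /= distrC.
  have := bp j; rewrite /= in_itv /= lt_min => /andP[xp /andP[_ px]].
  by rewrite ger0_norm ?subr_ge0// ltrBlDl.
rewrite ltxx; apply: contraPP => _; rewrite not_implyE; split.
  by move=> i; have /andP[] := x01 i.
rewrite not_implyE; split.
  by move=> i; have /andP[_ x1] := x01 i; rewrite lt_min x1 ltrDl /=.
by rewrite not_implyE; split => // i; rewrite ge_min lexx.
Qed.

Lemma torus_continuous_unique (g1 g2 : torus_pt R d -> R[i]) :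
  torus_continuous g1 -> torus_continuous g2 ->
  {ae torus_measure d, forall x, g1 x = g2 x} ->
  forall x, torus_cube x -> g1 x = g2 x.
Proof.
move=> [c1 c1'] [c2 c2'] g12 x cx.
have H (p : R[i] -> R) : continuous (fun y : 'rV[R]_d => p (g1 (mod1 (y 0)))) ->
    continuous (fun y : 'rV[R]_d => p (g2 (mod1 (y 0)))) -> p (g1 x) = p (g2 x).
  move=> p1 p2; apply/eqP; rewrite -subr_eq0; apply/eqP.
  apply: (@continuous_ae0 (fun x => p (g1 x) - p (g2 x))) => //.
    move=> y; exact: (@continuousB _ _ _ (fun y : 'rV[R]_d => p (g1 (mod1 (y 0))))
      (fun y : 'rV[R]_d => p (g2 (mod1 (y 0)))) y (p1 y) (p2 y)).
  by apply: filterS g12 => y ->; rewrite subrr.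
by apply/eqP; rewrite eq_complex (H _ c1 c2) (H _ c1' c2') !eqxx.
Qed.

Lemma continuous_repE f g : torus_continuous g ->
  {ae torus_measure d, forall x, f x = g x} ->
  forall x, torus_cube x -> continuous_rep f x = g x.
Proof.
move=> cg fg x cx.
have /(xgetPex f) [c' fc'] : exists g', [set g | torus_continuous g /\
    {ae torus_measure d, forall x, f x = g x}] g' by exists g.
apply: torus_continuous_unique => //.
apply: filterS2 fc' fg => y fy <-; exact/esym/fy.
Qed.

End continuous_representative.

(** * Summability of the Korobov weights *)

(** Dyadic blocks: the 2^m terms with 2^m <= n + 1 < 2^(m+1) sum to at most
(2^(1-p))^m. *)
Lemma zeta_partial_bound (R : realType) (p : R) (H : nat) : 1 < p ->
  \sum_(0 <= n < H) n.+1%:R `^ (- p) <= (1 - 2 `^ (1 - p))^-1.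
Proof.
move=> p1; set q := 2 `^ (1 - p).
have q0 : 0 < q by exact: powR_gt0.
have q1 : q < 1.
  rewrite -(powRr0 2) /q /powR pnatr_eq0 /= ltr_expR mul0r nmulr_rlt0 ?subr_lt0//.
  by rewrite ln_gt0// ltr1n.
have q1' : 0 < 1 - q by rewrite subr_gt0.
have a0 n : 0 <= n.+1%:R `^ (- p) :> R by exact: powR_ge0.
have dyadic m : \sum_(0 <= n < (2 ^ m).-1) n.+1%:R `^ (- p) <= (1 - q ^+ m) / (1 - q).
  elim: m => [|m IH]; first by rewrite big_geq// expr0 subrr mul0r.
  have P0 : (0 < 2 ^ m)%N by rewrite expn_gt0.
  have P1 : ((2 ^ m).-1 <= (2 ^ m.+1).-1)%N by rewrite expnS; lia.
  rewrite (big_cat_nat (n := (2 ^ m).-1))//=.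
  rewrite (_ : (1 - q ^+ m.+1) / (1 - q) = (1 - q ^+ m) / (1 - q) + q ^+ m); last first.
    by rewrite exprS; field; rewrite gt_eqF.
  apply: lerD IH _.
  apply: (@le_trans _ _ (\sum_((2 ^ m).-1 <= n < (2 ^ m.+1).-1) (2 ^ m)%:R `^ (- p))).
    rewrite !big_nat; apply: ler_sum => n /andP[mn _].
    rewrite !powRN lef_pV2 ?posrE ?powR_gt0 ?ltr0n//.
    rewrite ge0_ler_powR ?nnegrE ?(le_trans _ (ltW p1))// ler_nat; lia.
  rewrite sumr_const_nat (_ : _ - _ = 2 ^ m)%N; last by rewrite expnS; lia.
  rewrite -[_ *+ _]mulr_natl /q -powR_mulrn ?powR_ge0// -powRrM.
  have -> : (2 ^ m)%:R = 2 `^ m%:R :> R by rewrite powR_mulrn// natrX.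
  rewrite -powRrM -powRD; last by rewrite pnatr_eq0 implybT.
  by rewrite -[X in X + _]mulr1 mulrN -mulrBr mulrC.
have HH : (H <= (2 ^ H).-1)%N by have := ltn_expl H (isT : 1 < 2)%N; lia.
apply: (@le_trans _ _ (\sum_(0 <= n < (2 ^ H).-1) n.+1%:R `^ (- p))).
  by rewrite [leRHS](big_cat_nat (n := H))//= lerDl sumr_ge0.
apply: le_trans (dyadic H) _; rewrite ler_pdivrMr// mulVf ?gt_eqF//.
by rewrite lerBlDr lerDl exprn_ge0// ltW.
Qed.

Section korobov_weight.
Context {R : realType} (d : nat) (alpha : R) (gamma : 'I_d -> R).
Hypothesis alpha_gt0 : 0 < alpha.
Hypothesis gamma_gt0 : forall j, 0 < gamma j.
Hypothesis gamma_le1 : forall j, gamma j <= 1.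
Implicit Types (h : 'rV[int]_d).

Local Notation r := (korobov_weight alpha gamma).

Definition weight1 (j : 'I_d) (n : int) : R :=
  Num.max 1 ((gamma j)^-1 * `|n|%:~R `^ alpha).

Lemma weight1_ge1 j n : 1 <= weight1 j n.
Proof. by rewrite /weight1 le_max lexx. Qed.

Lemma korobov_weightE h : r h = \prod_(j < d) weight1 j (h 0 j).
Proof. by []. Qed.

Lemma korobov_weight_ge1 h : 1 <= r h.
Proof.
rewrite korobov_weightE; apply: (big_ind (fun x => 1 <= x)) => // [x y x1 y1|j _].
  by rewrite -[1]mulr1 ler_pM.
exact: weight1_ge1.
Qed.

Lemma korobov_weight_gt0 h : 0 < r h.
Proof. exact: lt_le_trans (korobov_weight_ge1 h). Qed.

Lemma korobov_weight0 : r 0 = 1.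
Proof.
rewrite korobov_weightE big1// => j _.
by rewrite /weight1 mxE normr0 powR0 ?gt_eqF// mulr0 max_l.
Qed.

Lemma weight1_le_weight h j : weight1 j (h 0 j) <= r h.
Proof.
rewrite korobov_weightE (bigD1 j)//= ler_peMr ?(le_trans _ (weight1_ge1 _ _))//.
apply: (big_ind (fun x => 1 <= x)) => // [x y x1 y1|i _].
  by rewrite -[1]mulr1 ler_pM.
exact: weight1_ge1.
Qed.

Lemma freq_le_weight h j : `|h 0 j|%:~R <= r h `^ alpha^-1.
Proof.
have n0 : 0 <= `|h 0 j|%:~R :> R by rewrite ler0z.
have -> : `|h 0 j|%:~R = (`|h 0 j|%:~R `^ alpha) `^ alpha^-1 :> R.
  by rewrite -powRrM mulfV ?gt_eqF// powRr1.
apply: ge0_ler_powR; rewrite ?nnegrE ?powR_ge0 ?invr_ge0 ?(ltW alpha_gt0)//.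
  exact: ltW (korobov_weight_gt0 _).
apply: le_trans (weight1_le_weight h j); rewrite /weight1 le_max; apply/orP; right.
by rewrite ler_peMl ?powR_ge0// invf_ge1// gamma_gt0.
Qed.

(** The integers of the interval [-H, H], indexed by a finite type that follows the two
constructors of [int]; this lets sums over a box factor over the coordinates. *)
Definition box_int (H : nat) (i : 'I_H + 'I_H.+1) : int :=
  match i with inl m => Negz m | inr m => Posz m end.

Definition box_index (H : nat) (n : int) : 'I_H + 'I_H.+1 :=
  match n with
  | Negz m => if insub m is Some i then inl i else inr ord0
  | Posz m => inr (inord m)
  end.

Lemma box_indexK H n : (`|n| <= H)%N -> box_int (box_index H n) = n.
Proof.
case: n => m /= mH; first by rewrite inordK.
by rewrite insubT.
Qed.

Definition box_point H (f : {ffun 'I_d -> 'I_H + 'I_H.+1}) : 'rV[int]_d :=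
  \row_j box_int (f j).

Definition box_code H h : {ffun 'I_d -> 'I_H + 'I_H.+1} :=
  [ffun j => box_index H (h 0 j)].

Lemma box_codeK H h : (forall j, (absz (h 0%R j) <= H)%N) -> box_point (box_code H h) = h.
Proof. by move=> hH; apply/rowP => j; rewrite mxE ffunE box_indexK. Qed.

Lemma finite_freq_set (N : R) : finite_set (freq_set alpha gamma N).
Proof.
pose H := Num.truncn (N `^ alpha^-1).
apply: (@sub_finite_set _ _ ((fun f => @box_point H f) @` setT)); last first.
  by apply: finite_image; exact: finite_finset.
move=> h /= hN; exists (box_code H h) => //; apply: box_codeK => j.
rewrite /H truncn_ge_nat ?powR_ge0//.
have -> : (absz (h 0 j))%:R = `|h 0 j|%:~R :> R by rewrite -abszE.
apply: le_trans (freq_le_weight h j) _; apply: ge0_ler_powR => //.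
- by rewrite invr_ge0 ltW.
- exact: ltW (korobov_weight_gt0 _).
- by rewrite nnegrE (le_trans _ hN)// ltW// korobov_weight_gt0.
Qed.

Lemma weight1_powRN_le j (n : int) (m : nat) (s : R) : 0 <= s -> (`|n| = m.+1)%N ->
  weight1 j n `^ (- s) <= gamma j `^ s * m.+1%:R `^ (- (alpha * s)).
Proof.
move=> s0 nm; have -> : gamma j `^ s * m.+1%:R `^ (- (alpha * s)) =
    ((gamma j)^-1 * m.+1%:R `^ alpha) `^ (- s).
  rewrite powRM ?powR_ge0 ?invr_ge0 ?(ltW (gamma_gt0 j))// -powRrM mulrN; congr (_ * _).
  by rewrite -powR_inv1 ?(ltW (gamma_gt0 j))// -powRrM mulrNN mul1r.
have p0 : 0 < (gamma j)^-1 * m.+1%:R `^ alpha by rewrite mulr_gt0 ?invr_gt0 ?powR_gt0.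
rewrite !powRN lef_pV2 ?posrE ?powR_gt0//; last exact: lt_le_trans (weight1_ge1 _ _).
apply: ge0_ler_powR => //; rewrite ?nnegrE ?(ltW p0)//.
  exact: le_trans (weight1_ge1 _ _).
by rewrite /weight1 -abszE nm le_max lexx orbT.
Qed.

Lemma weight1_box_sum j (s Z : R) (H : nat) : 0 <= s ->
  (forall H, \sum_(0 <= n < H) n.+1%:R `^ (- (alpha * s)) <= Z) ->
  \sum_(i : 'I_H + 'I_H.+1) weight1 j (box_int i) `^ (- s) <= 1 + 2 * Z * gamma j `^ s.
Proof.
move=> s0 hZ; rewrite big_sumType /= big_ord_recl /=.
have -> : weight1 j 0 = 1.
  by rewrite /weight1 normr0 powR0 ?gt_eqF// mulr0 max_l.
have e1 : \sum_(i < H) weight1 j (Negz i) `^ (- s) <= gamma j `^ s * Z.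
  apply: le_trans (_ : gamma j `^ s * (\sum_(i < H) i.+1%:R `^ (- (alpha * s))) <= _).
    by rewrite mulr_sumr; apply: ler_sum => i _; exact: weight1_powRN_le.
  by rewrite ler_wpM2l ?powR_ge0// -(big_mkord xpredT (fun i => i.+1%:R `^ (- (alpha * s)))).
have e2 : \sum_(i < H) weight1 j (Posz (lift ord0 i)) `^ (- s) <= gamma j `^ s * Z.
  apply: le_trans (_ : gamma j `^ s * (\sum_(i < H) i.+1%:R `^ (- (alpha * s))) <= _).
    by rewrite mulr_sumr; apply: ler_sum => i _; exact: weight1_powRN_le.
  by rewrite ler_wpM2l ?powR_ge0// -(big_mkord xpredT (fun i => i.+1%:R `^ (- (alpha * s)))).
rewrite powR1 addrCA lerD2l; apply: le_trans (lerD e1 e2) _.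
by rewrite (_ : 2 * Z * gamma j `^ s = gamma j `^ s * Z + gamma j `^ s * Z)//; ring.
Qed.

Lemma ler_sum_uniq (I : finType) (t : seq I) (F : I -> R) : uniq t ->
  (forall i, 0 <= F i) -> \sum_(i <- t) F i <= \sum_i F i.
Proof.
move=> ut F0; rewrite big_uniq//= [leRHS](bigID (fun i => i \in t)) /= lerDl.
by apply: sumr_ge0.
Qed.

Lemma powR_prod (I : Type) (t : seq I) (F : I -> R) (s : R) : (forall i, 0 <= F i) ->
  (\prod_(i <- t) F i) `^ s = \prod_(i <- t) F i `^ s.
Proof.
move=> F0; elim: t => [|i t IH]; first by rewrite !big_nil powR1.
by rewrite !big_cons powRM ?IH// prodr_ge0.
Qed.

(** A finite set of frequencies lies in a box, the sum over the box is the product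
of one-dimensional sums, and 1 + x <= exp x. *)
Lemma korobov_weight_sum (s Z : R) (G : seq 'rV[int]_d) : 0 <= s -> uniq G ->
  (forall H, \sum_(0 <= n < H) n.+1%:R `^ (- (alpha * s)) <= Z) ->
  \sum_(h <- G) r h `^ (- s) <= expR (2 * Z * \sum_(j < d) gamma j `^ s).
Proof.
move=> s0 uG hZ.
have [H hGH] : exists H, forall h, h \in G -> forall j, (absz (h 0%R j) <= H)%N.
  exists (\max_(h <- G) \max_(j < d) absz (h 0%R j)) => h hG j.
  apply: leq_trans (leq_bigmax_seq (F := fun h : 'rV[int]_d => \max_(j < d) absz (h 0%R j)) h hG isT).
  exact: (@leq_bigmax _ (fun j : 'I_d => absz (h 0%R j)) j).
have hH h : h \in G -> box_point (box_code H h) = h.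
  by move=> hG; apply: box_codeK; exact: hGH.
rewrite (eq_big_seq (fun h => r (box_point (box_code H h)) `^ (- s))); last first.
  by move=> h hG; rewrite (hH _ hG).
rewrite -(big_map (box_code H) xpredT (fun f => r (box_point f) `^ (- s))).
apply: le_trans (ler_sum_uniq _ _) _.
- rewrite map_inj_in_uniq// => a b aG bG /(congr1 (@box_point H)).
  by rewrite (hH _ aG) (hH _ bG).
- by move=> f; exact: powR_ge0.
rewrite (eq_bigr (fun f : {ffun 'I_d -> 'I_H + 'I_H.+1} =>
    \prod_(j < d) weight1 j (box_int (f j)) `^ (- s))); last first.
  move=> f _; rewrite korobov_weightE powR_prod => [|j].
    by apply: eq_bigr => j _; rewrite mxE.
  exact: le_trans (weight1_ge1 _ _).
rewrite -(bigA_distr_bigA (fun j i => weight1 j (box_int i) `^ (- s))) /=.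
rewrite mulr_sumr expR_sum; apply: ler_prod => j _; apply/andP; split.
  by apply: sumr_ge0 => i _; exact: powR_ge0.
by apply: le_trans (weight1_box_sum _ _ s0 hZ) _; exact: expR_ge1Dx.
Qed.

End korobov_weight.

(** * Series with coefficients in the Korobov ball *)

Lemma poweR_half_le1 (R : realType) (x : \bar R) :
  (0 <= x)%E -> (x `^ 2^-1 <= 1)%E -> (x <= 1)%E.
Proof.
move=> x0; apply: contraTT; rewrite -!ltNge; case: x x0 => [r| |] // r0 r1.
  rewrite poweR_EFin lte_fin in r1 *.
  apply: (@le_lt_trans _ _ (1 `^ 2^-1)); first by rewrite powR1.
  by apply: gt0_ltr_powR => //; rewrite nnegrE.
by rewrite (@poweRyr R) ?invr_eq0// ltry.
Qed.

Section korobov_series.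
Context {R : realType} (d : nat) (alpha : R) (gamma : 'I_d -> R) (s K : R).
Hypothesis alpha_gt0 : 0 < alpha.
Hypothesis gamma_gt0 : forall j, 0 < gamma j.
Hypothesis gamma_le1 : forall j, gamma j <= 1.
Hypothesis s_lt1 : s < 1.
Hypothesis K_gt0 : 0 < K.
Local Notation r := (korobov_weight alpha gamma).
Hypothesis weight_sum : forall G : seq 'rV[int]_d, uniq G ->
  \sum_(h <- G) r h `^ (- s) <= K.
Let r_gt0 h : 0 < r h := korobov_weight_gt0 alpha gamma h.

(** Each h with r(h) <= N contributes at least N^-s to the weight sum. *)
Lemma card_freq_set (N : R) : 0 <= s -> 0 <= N ->
  #|` fset_set (freq_set alpha gamma N)|%fset%:R <= N `^ s * K.
Proof.
move=> s0 N0; have fA := finite_freq_set alpha_gt0 gamma_gt0 gamma_le1 N.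
apply: (@le_trans _ _ (N `^ s * \sum_(h <- fset_set (freq_set alpha gamma N)) r h `^ (- s))); last first.
  by rewrite ler_wpM2l ?powR_ge0// weight_sum// fset_uniq.
rewrite -[X in X%:R]sum1_size natr_sum mulr_sumr !big_seq; apply: ler_sum => h.
rewrite in_fset_set// inE /= => hN.
rewrite powRN -ler_pdivrMr ?invr_gt0 ?powR_gt0// invrK mul1r.
by apply: ge0_ler_powR; rewrite ?nnegrE// ltW.
Qed.

Definition tail_bound (N : R) : R := K `^ 2^-1 * N `^ (- ((1 - s) / 2)).

Variable c : 'rV[int]_d -> R[i].
Hypothesis c_ball : forall G : seq 'rV[int]_d, uniq G ->
  \sum_(h <- G) r h * Normc.normc (c h) ^+ 2 <= 1.

(** Cauchy-Schwarz in the form 2 |c| <= lam r |c|^2 + 1 / (lam r), with lam the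
bound itself, together with 1 / r <= N^(-(1-s)) r^-s on the range of summation. *)
Lemma sum_normc_tail (N : R) (G : seq 'rV[int]_d) : 0 < N -> uniq G ->
  (forall h, h \in G -> N <= r h) ->
  \sum_(h <- G) Normc.normc (c h) <= tail_bound N.
Proof.
move=> N0 uG GN; set lam := tail_bound N.
have lam0 : 0 < lam by rewrite mulr_gt0 ?powR_gt0.
have lam2 : lam ^+ 2 = K * N `^ (- (1 - s)).
  rewrite exprMn -!powR_mulrn ?powR_ge0// -!powRrM mulVf// powRr1 ?(ltW K_gt0)//.
  by congr (_ * _ `^ _); field.
have invsum : \sum_(h <- G) (r h)^-1 <= lam ^+ 2.
  apply: (@le_trans _ _ (\sum_(h <- G) N `^ (- (1 - s)) * r h `^ (- s))).
    rewrite !big_seq; apply: ler_sum => h hG.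
    have -> : (r h)^-1 = r h `^ (- (1 - s)) * r h `^ (- s).
      have rn0 : r h != 0 by rewrite gt_eqF.
      rewrite -powRD ?rn0 ?implybT// (_ : - (1 - s) + - s = -1); last by ring.
      by rewrite powR_inv1// ltW.
    rewrite ler_wpM2r ?powR_ge0// !powRN lef_pV2 ?posrE ?powR_gt0//.
    by apply: ge0_ler_powR; rewrite ?nnegrE ?(ltW N0) ?(ltW (r_gt0 _)) ?GN// subr_ge0 ltW.
  by rewrite -mulr_sumr lam2 mulrC ler_wpM2r ?powR_ge0// weight_sum.
apply: (@le_trans _ _ (\sum_(h <- G)
    2^-1 * (lam * (r h * Normc.normc (c h) ^+ 2) + lam^-1 * (r h)^-1))).
  apply: ler_sum => h _; set a := Normc.normc (c h).
  have x0 : 0 < lam * r h by rewrite mulr_gt0.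
  have -> : lam * (r h * a ^+ 2) + lam^-1 * (r h)^-1 =
      (lam * r h) * (a - (lam * r h)^-1) ^+ 2 + 2 * a.
    by field; rewrite !gt_eqF.
  have half (X : R) : 0 <= X -> a <= 2^-1 * (X + 2 * a) by move=> X0; lra.
  by apply: half; rewrite mulr_ge0 ?sqr_ge0 ?(ltW x0).
rewrite -mulr_sumr big_split /= -!mulr_sumr.
apply: (@le_trans _ _ (2^-1 * (lam * 1 + lam^-1 * lam ^+ 2))).
  rewrite ler_wpM2l ?invr_ge0// lerD// ler_wpM2l ?invr_ge0 ?(ltW lam0)//.
  exact: c_ball.
by rewrite le_eqVlt; apply/orP; left; apply/eqP; field; rewrite gt_eqF.
Qed.

(** The level is n + 1 rather than n: [tail_bound] is not a bound at 0, where [powR]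
takes its default value. *)
Definition freq_seq (n : nat) : seq 'rV[int]_d :=
  fset_set (freq_set alpha gamma n.+1%:R).

Lemma mem_freq_seq n h : (h \in freq_seq n) = (r h <= n.+1%:R).
Proof.
rewrite /freq_seq in_fset_set; last exact: finite_freq_set.
by apply/idP/idP; rewrite inE.
Qed.

Lemma freq_seq_uniq n : uniq (freq_seq n).
Proof. exact: fset_uniq. Qed.

Lemma freq_seq_exhaust h : \forall n \near \oo, h \in freq_seq n.
Proof.
exists (Num.truncn (r h)) => // n /= hn; rewrite mem_freq_seq ltW//.
by apply: lt_le_trans (truncnS_gt _) _; rewrite ler_nat ltnS.
Qed.

Lemma freq_seq_rate m n (x : torus_pt R d) : (m <= n)%N ->
  Normc.normc (\sum_(k <- freq_seq n) c k * character k x -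
               \sum_(k <- freq_seq m) c k * character k x) <= tail_bound m.+1%:R.
Proof.
move=> mn; rewrite (bigID (fun k => k \in freq_seq m)) /=.
have -> : \sum_(k <- freq_seq n | k \in freq_seq m) c k * character k x =
    \sum_(k <- freq_seq m) c k * character k x.
  rewrite -big_filter; apply: perm_big; apply: uniq_perm; rewrite ?filter_uniq ?freq_seq_uniq//.
  move=> k; rewrite mem_filter !mem_freq_seq andb_idr// => /le_trans; apply.
  by rewrite ler_nat.
rewrite addrAC subrr add0r -big_filter; apply: le_trans (normc_sum _ _ _) _.
under eq_bigr do rewrite Normc.normcM normc_character mulr1.
apply: sum_normc_tail; rewrite ?ltr0n ?filter_uniq ?freq_seq_uniq// => k.
by rewrite mem_filter !mem_freq_seq -ltNge => /andP[/ltW].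
Qed.

Lemma tail_bound_cvg0 : (fun n => tail_bound n.+1%:R) @ \oo --> (0 : R).
Proof.
rewrite -[X in _ --> X](mulr0 (K `^ 2^-1)); apply: cvgM; first exact: cvg_cst.
have p0 : 0 < (1 - s) / 2 by rewrite divr_gt0 ?subr_gt0.
have -> : (fun n => n.+1%:R `^ (- ((1 - s) / 2))) =
    (fun a : R => a `^ ((1 - s) / 2)) \o harmonic.
  by apply/funext => n; rewrite /= /harmonic -(@powR_inv1 _ n.+1%:R)// -powRrM mulN1r.
apply: cvg_comp (powR_cvg0 p0) => A A0.
have nA : \forall n \near \oo, 0 < harmonic n -> A (harmonic n) := cvg_harmonic A0.
by apply: (filterS _ nA) => n; apply; exact: harmonic_gt0.
Qed.

Definition korobov_series := uniform_sum freq_seq c.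

Lemma tail_bound_ge0 N : 0 <= tail_bound N.
Proof. by rewrite mulr_ge0 ?powR_ge0. Qed.

(** The error is compared with that of the partial sums, for which
[lattice_error_polynomial] and [sum_normc_tail] give the claim; the difference
is at most a constant times the tail bound at n, which tends to 0. *)
Lemma lattice_error_series (N : R) (L : nat) (z : nat -> 'rV[int]_d) (Ms : nat -> nat)
    (g : torus_pt R d -> R[i]) (x : torus_pt R d) :
  let A := freq_set alpha gamma N in
  0 < N -> (forall l, (l < L)%N -> (0 < Ms l)%N) ->
  A = \bigcup_(l in `I_L) freqs z Ms A l ->
  (forall y, torus_cube y -> g y = korobov_series y) ->
  Normc.normc (korobov_series x - lattice_op L z Ms A g x) <= (1 + L%:R) * tail_bound N.
Proof.
move=> A N0 Ms0 AE gE.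
have fA : finite_set A by exact: finite_freq_set.
pose P n (x : torus_pt R d) := \sum_(k <- freq_seq n) c k * character k x.
pose e n := tail_bound n.+1%:R.
pose C : R := (\sum_(l < L) #|` fset_set (freqs z Ms A l)|%fset)%:R.
have close n y : Normc.normc (korobov_series y - P n y) <= 2 * e n.
  by apply: uniform_sum_close => [m k w mk|]; [exact: freq_seq_rate|exact: tail_bound_cvg0].
have step n : Normc.normc (korobov_series x - lattice_op L z Ms A g x) <=
    2 * e n + (1 + L%:R) * tail_bound N + C * (2 * e n).
  rewrite (_ : korobov_series x - _ = (korobov_series x - P n x) +
    (P n x - lattice_op L z Ms A (P n) x) +
    (lattice_op L z Ms A (P n) x - lattice_op L z Ms A g x)); last by ring.
  apply: le_trans (normcD _ _) _; apply: lerD; last first.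
    apply: lattice_op_close => // l j; rewrite -normcN opprB gE; first exact: close.
    exact: mod1_cube.
  apply: le_trans (normcD _ _) _; apply: lerD; first exact: close.
  rewrite /P; apply: (le_trans (lattice_error_polynomial Ms0 (freq_seq n) c x fA AE)).
  rewrite ler_wpM2l ?addr_ge0// -big_filter; apply: sum_normc_tail => //.
    by rewrite filter_uniq ?freq_seq_uniq.
  move=> h; rewrite mem_filter => /andP[/negP hA _].
  by rewrite leNgt; apply/negP => /ltW hN; apply: hA; rewrite inE.
have lim : (fun n => 2 * e n + (1 + L%:R) * tail_bound N + C * (2 * e n)) @ \oo -->
    2 * 0 + (1 + L%:R) * tail_bound N + C * (2 * 0).
  have e2 : (fun n => 2 * e n) @ \oo --> (2 * 0 : R).
    by apply: cvgM; [exact: cvg_cst|exact: tail_bound_cvg0].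
  by apply: cvgD; [apply: cvgD => //; exact: cvg_cst|apply: cvgM => //; exact: cvg_cst].
rewrite !mulr0 addr0 add0r in lim.
apply: (@closed_cvg _ _ \oo _ (fun n => 2 * e n + (1 + L%:R) * tail_bound N + C * (2 * e n))
  (fun y => Normc.normc (korobov_series x - lattice_op L z Ms A g x) <= y)); last exact: lim.
  exact: closed_ge.
exact: nearW.
Qed.

End korobov_series.

(** * The worst-case error *)

Lemma korobov_ball_sum (R : realType) d (alpha : R) (gamma : 'I_d -> R)
    (f : torus_pt R d -> R[i]) (G : seq 'rV[int]_d) :
  (korobov_norm alpha gamma f <= 1)%E -> uniq G ->
  \sum_(h <- G) korobov_weight alpha gamma h * Normc.normc (fourier_coef f h) ^+ 2 <= 1.
Proof.
move=> f1 uG.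
have w0 h : (0 <= (korobov_weight alpha gamma h * Normc.normc (fourier_coef f h) ^+ 2)%:E)%E.
  by rewrite lee_fin mulr_ge0 ?sqr_ge0// ltW// korobov_weight_gt0.
have : (\esum_(h in [set: 'rV[int]_d])
   (korobov_weight alpha gamma h * Normc.normc (fourier_coef f h) ^+ 2)%:E <= 1)%E.
  by apply: poweR_half_le1 => //; apply: esum_ge0 => h _.
rewrite -lee_fin -sumEFin; apply: le_trans.
apply: esum_ge; exists [set` G]; first by split => //; exact: finite_seq.
by rewrite fsbig_seq.
Qed.

Lemma Linfty_norm_le (R : realType) d (f : torus_pt R d -> R[i]) (e : R) :
  {ae torus_measure d, forall x, Normc.normc (f x) <= e} ->
  (Linfty_norm f <= e%:E)%E.
Proof.
move=> fe; rewrite /Linfty_norm unlock /=.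
have T0 : (0 < @torus_measure R d setT)%E.
  by have /= -> := @probability_setT _ _ _ (@torus_measure R d); rewrite lte01.
rewrite T0; apply: ereal_inf_lbound => /=.
apply: filterS fe => x fx; by rewrite lee_fin ger0_norm//; exact: normc_ge0.
Qed.

Lemma korobov_lattice_error (R : realType) d (alpha : R) (gamma : 'I_d -> R) (s K N : R)
    (L : nat) (z : nat -> 'rV[int]_d) (Ms : nat -> nat) (f : torus_pt R d -> R[i]) :
  let A := freq_set alpha gamma N in
  0 < alpha -> (forall j, 0 < gamma j) -> (forall j, gamma j <= 1) ->
  s < 1 -> 0 < K ->
  (forall G : seq 'rV[int]_d, uniq G ->
    \sum_(h <- G) korobov_weight alpha gamma h `^ (- s) <= K) ->
  0 < N -> (forall l, (l < L)%N -> (0 < Ms l)%N) ->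
  A = \bigcup_(l in `I_L) freqs z Ms A l ->
  korobov_space alpha gamma f -> (korobov_norm alpha gamma f <= 1)%E ->
  (Linfty_norm (fun x => f x - lattice_approx L z Ms A f x)%R <=
    ((1 + L%:R) * tail_bound s K N)%:E)%E.
Proof.
move=> A a0 g0 g1 s1 K0 wsum N0 Ms0 AE [Lf _] f1; apply: Linfty_norm_le.
have ball G := @korobov_ball_sum _ _ _ _ _ G f1.
have rate m n x (mn : (m <= n)%N) := freq_seq_rate a0 g0 g1 s1 K0 wsum ball x mn.
have e0 := tail_bound_cvg0 K s1.
have fg := ae_eq_uniform_sum rate e0 (@freq_seq_uniq _ _ _ _) (@freq_seq_exhaust _ _ _ _ a0 g0 g1)
   Lf (fun h => erefl).
have cg := torus_continuous_uniform_sum rate e0.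
have repE := continuous_repE cg fg.
apply: filterS fg => x ->.
exact: (lattice_error_series a0 g0 g1 s1 K0 wsum ball x N0 Ms0 AE repE).
Qed.

(** * Choice of the exponents *)

Lemma ln_max1_le_powR (R : realType) (a delta : R) : 1 <= a -> 0 < delta ->
  Num.max (ln a) 1 <= Num.max 1 delta^-1 * a `^ delta.
Proof.
move=> a1 d0; have a0 : 0 < a by exact: lt_le_trans a1.
have p1 : 1 <= a `^ delta by rewrite -(powRr0 a) ler_powR// ltW.
have p0 := powR_gt0 delta a0.
rewrite ge_max; apply/andP; split.
  apply: (@le_trans _ _ (delta^-1 * a `^ delta)); last first.
    by rewrite ler_wpM2r ?(ltW p0)// le_max lexx orbT.
  rewrite ler_pdivlMl// -ln_powR.
  by have := @le_ln1Dx R (a `^ delta - 1); rewrite addrCA subrr addr0; lra.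
by rewrite -[leLHS]mulr1 ler_pM// le_max lexx.
Qed.

(** Here a stands for |A|.  From N^s >= a / K the tail is at most
K^(1/2+tau) a^-tau.  Both 1 + L and (M / a)^t are bounded by powers of
max (ln a) 1, which is at most a multiple of a^((tau-t)/(1+t)); the total
exponent 1 + t of this factor uses up exactly the gap tau - t. *)
Lemma error_bound (R : realType) (a N K s t L M : R) :
  let tau := (s^-1 - 1) / 2 in
  1 <= a -> 1 <= N -> 1 <= K -> 0 < s -> s < 1 -> 0 < t -> t < tau ->
  a <= N `^ s * K -> 0 <= L -> L <= Num.max (3 * ln a) 1 -> 0 < M ->
  M <= 9 * a * Num.max (ln a) 1 ->
  (1 + L) * tail_bound s K N <=
  4 * 9 `^ t * Num.max 1 ((tau - t) / (1 + t))^-1 `^ (1 + t) * K `^ (2^-1 + tau) * M `^ (- t).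
Proof.
move=> tau a1 N1 K1 s0 s1 t0 ttau aN L0 LE M0 ME.
set D := Num.max 1 ((tau - t) / (1 + t))^-1; set l := Num.max (ln a) 1 in ME *.
have a0 : 0 < a by exact: lt_le_trans a1.
have K0 : 0 < K by exact: lt_le_trans K1.
have N0 : 0 < N by exact: lt_le_trans N1.
have t1 : 0 < 1 + t by lra.
have del0 : 0 < (tau - t) / (1 + t) by rewrite divr_gt0// subr_gt0.
have l1 : 1 <= l by rewrite /l le_max lexx orbT.
have l0 : 0 < l by exact: lt_le_trans l1.
have lD : l <= D * a `^ ((tau - t) / (1 + t)) by exact: ln_max1_le_powR.
have L4 : 1 + L <= 4 * l.
  apply: (@le_trans _ _ (1 + 3 * l)); last by lra.
  rewrite lerD2l (le_trans LE)// ge_max; apply/andP; split; last by lra.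
  by rewrite ler_pM2l// /l le_max lexx.
have tau0 : 0 < tau by exact: lt_trans ttau.
have NE : N `^ (- ((1 - s) / 2)) <= K `^ tau * a `^ (- tau).
  have -> : N `^ (- ((1 - s) / 2)) = (N `^ s) `^ (- tau).
    by rewrite -powRrM; congr (_ `^ _); rewrite /tau; field; rewrite gt_eqF.
  have -> : K `^ tau * a `^ (- tau) = (a / K) `^ (- tau).
    rewrite powRM ?invr_ge0 ?(ltW a0) ?(ltW K0)// mulrC; congr (_ * _).
    by rewrite -(powR_inv1 (ltW K0)) -powRrM mulrNN mul1r.
  have aK0 : 0 < a / K by rewrite divr_gt0.
  rewrite !powRN lef_pV2 ?posrE ?powR_gt0//.
  apply: ge0_ler_powR; rewrite ?nnegrE ?powR_ge0 ?(ltW tau0) ?(ltW aK0)//.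
  by rewrite ler_pdivrMr.
have tb : tail_bound s K N <= K `^ (2^-1 + tau) * a `^ (- tau).
  have K00 : K != 0 by rewrite gt_eqF.
  rewrite /tail_bound powRD ?K00 ?implybT//.
  by rewrite -mulrA ler_wpM2l ?powR_ge0.
have Mt : M `^ t <= 9 `^ t * a `^ t * l `^ t.
  rewrite -!powRM ?mulr_ge0 ?(ltW a0) ?(ltW l0)//.
  by apply: ge0_ler_powR; rewrite ?nnegrE ?mulr_ge0 ?(ltW a0) ?(ltW l0) ?(ltW t0) ?(ltW M0).
rewrite powRN ler_pdivlMr ?powR_gt0//.
have tb0 : 0 <= tail_bound s K N by exact: tail_bound_ge0.
apply: (@le_trans _ _ ((4 * l) * (K `^ (2^-1 + tau) * a `^ (- tau)) * (9 `^ t * a `^ t * l `^ t))).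
  have L10 : 0 <= 1 + L by exact: addr_ge0.
  apply: ler_pM => //; [exact: mulr_ge0|exact: powR_ge0|exact: ler_pM].
have ll : l * l `^ t <= D `^ (1 + t) * a `^ (tau - t).
  rewrite -{1}(powRr1 (ltW l0)) -powRD ?(gt_eqF l0) ?implybT//.
  have D0 : 0 <= D by rewrite /D le_max ler01.
  apply: (@le_trans _ _ ((D * a `^ ((tau - t) / (1 + t))) `^ (1 + t))).
    by apply: ge0_ler_powR; rewrite ?nnegrE ?mulr_ge0 ?powR_ge0 ?(ltW t1) ?(ltW l0).
  rewrite powRM ?powR_ge0// -powRrM divfK// gt_eqF//.
have aE : a `^ (- tau) * a `^ t * a `^ (tau - t) = 1.
  have a00 : a != 0 by rewrite gt_eqF.
  rewrite -!powRD ?a00 ?implybT// (_ : - tau + t + (tau - t) = 0) ?powRr0//; ring.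
rewrite (_ : 4 * l * _ * _ =
  4 * 9 `^ t * K `^ (2^-1 + tau) * (a `^ (- tau) * a `^ t) * (l * l `^ t)); last by ring.
apply: (@le_trans _ _ (4 * 9 `^ t * K `^ (2^-1 + tau) * (a `^ (- tau) * a `^ t) *
    (D `^ (1 + t) * a `^ (tau - t)))).
  by rewrite ler_wpM2l// !mulr_ge0 ?powR_ge0.
rewrite (_ : _ * (D `^ (1 + t) * a `^ (tau - t)) = 4 * 9 `^ t * D `^ (1 + t) * K `^ (2^-1 + tau) *
  (a `^ (- tau) * a `^ t * a `^ (tau - t))); last by ring.
by rewrite aE mulr1.
Qed.

(** The hypothesis on t says that alpha and 1 / t_gamma both exceed 1 + 2t, so there is
an s below 1 / (1 + 2t) that exceeds 1 / alpha and is at least some exponent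
admissible in the definition of t_gamma; raising an exponent keeps it admissible
since gamma <= 1. *)
Lemma exponent_choice (R : realType) (alpha : R) (gamma : forall d : nat, 'I_d -> R) (t : R) :
  1 < alpha ->
  (forall (d : nat) (j : 'I_d), 0 < gamma d j) ->
  (forall (d : nat) (j : 'I_d), gamma d j <= 1) ->
  0 < t -> (t%:E < (alpha_tilde gamma alpha - 1) / 2%:E)%E ->
  exists s C : R, [/\ 0 < s < 1, 1 < alpha * s, t < (s^-1 - 1) / 2, 0 <= C &
    forall d, (1 <= d)%N -> \sum_(j < d) gamma d j `^ s <= C * ln d.+1%:R].
Proof.
move=> alpha1 g0 g1 t0; rewrite inver ifF ?pnatr_eq0// lte_pdivlMr// lteBrDr// -EFinM -EFinD lt_min.
have alpha0 : 0 < alpha by exact: lt_trans alpha1.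
set q := t * 2 + 1; have q1 : 1 < q by rewrite /q; lra.
have q0 : 0 < q by exact: lt_trans q1.
rewrite lte_fin => /andP[qalpha].
have tg0 : (0 <= t_gamma gamma)%E.
  by apply/ereal_infP => _ [s [s0 _] <-]; rewrite lee_fin.
rewrite inve_pgt ?inE ?lee_fin ?(ltW q0)// inver gt_eqF// => /ereal_inf_lt.
move=> [_ [s' [s'0 supfin] <-]]; rewrite lte_fin => s'q.
set S := ereal_sup _ in supfin.
have inS d : (1 <= d)%N -> (((\sum_(j < d) gamma d j `^ s') / ln d.+1%:R)%:E <= S)%E.
  by move=> d1; apply: ereal_sup_ubound; exists d.
have Sfin : S \is a fin_num.
  by rewrite fin_numElt supfin andbT (lt_le_trans _ (inS 1%N isT))// ltNyr.
have aq : alpha^-1 < q^-1 by rewrite ltf_pV2 ?posrE.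
have ai0 : 0 < alpha^-1 by rewrite invr_gt0.
have qi1 : q^-1 < 1 by rewrite invf_lt1.
exists (Num.max s' ((alpha^-1 + q^-1) / 2)), (Num.max 0 (fine S)).
set s := Num.max s' _.
have sq : s < q^-1 by rewrite gt_max s'q /=; lra.
have sa : alpha^-1 < s by rewrite lt_max; apply/orP; right; lra.
have s0 : 0 < s by exact: lt_trans sa.
split.
- by rewrite s0 (lt_trans sq).
- by rewrite mulrC -ltr_pdivrMr// div1r.
- have : q < s^-1 by rewrite -(invrK q) ltf_pV2 ?posrE ?invr_gt0.
  by rewrite /q; lra.
- by rewrite le_max lexx.
- move=> d d1; have l0 : 0 < ln d.+1%:R :> R by rewrite ln_gt0// ltr1n.
  rewrite -ler_pdivrMr//; apply: (@le_trans _ _ (fine S)); last by rewrite le_max lexx orbT.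
  rewrite -lee_fin fineK//; apply: le_trans (inS _ d1).
  rewrite lee_fin ler_pM2r ?invr_gt0//; apply: ler_sum => j _.
  by apply: ger_powR; [rewrite g0 g1|rewrite le_max lexx].
Qed.

Theorem corollary4p8 (R : realType) (alpha : R)
    (gamma : forall d : nat, 'I_d -> R)
    (alpha_gt1 : 1 < alpha)
    (gamma_gt0 : forall (d : nat) (j : 'I_d), 0 < gamma d j)
    (gamma_le1 : forall (d : nat) (j : 'I_d), gamma d j <= 1)
    (gamma_noninc : forall (d : nat) (i j : 'I_d),
       (i <= j)%N -> gamma d j <= gamma d i)
    (t_gamma_lt1 : (t_gamma gamma < 1)%E)
    (t : R) (t_gt0 : 0 < t)
    (t_lt : (t%:E < (alpha_tilde gamma alpha - 1) / 2%:E)%E) :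
  exists c beta : R,
  forall (d : nat) (N : R) (L : nat) (z : nat -> 'rV[int]_d) (Ms : nat -> nat),
    let A := freq_set alpha (gamma d) N in
    let cardA := #|` fset_set A|%fset in
    let M := #|` fset_set (@multi_lattice R d L z Ms)|%fset in
    (1 <= d)%N -> 1 <= N -> (1 <= L)%N ->
    (forall l, (l < L)%N -> (1 <= Ms l)%N) ->
    A = \bigcup_(l in `I_L) freqs z Ms A l ->
    L%:R <= Num.max (3 * ln cardA%:R) 1 :> R ->
    (forall l, (l < L)%N -> Ms l = Ms 0%N) ->
    (Ms 0%N <= 3 * cardA)%N ->
    (2 * cardA < M)%N ->
    M%:R < 9 * cardA%:R * Num.max (ln cardA%:R) 1 :> R ->
    (ereal_sup [set Linfty_norm (fun x => f x - lattice_approx L z Ms A f x)%R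
               | f in [set f | korobov_space alpha (gamma d) f /\
                               (korobov_norm alpha (gamma d) f <= 1)%E]]
     < (c * d%:R `^ beta * M%:R `^ (- t))%:E)%E.
Proof.
have alpha0 : 0 < alpha by exact: lt_trans alpha_gt1.
have [s [C [/andP[s0 s1] as1 ts C0 sumC]]] :=
  exponent_choice alpha_gt1 gamma_gt0 gamma_le1 t_gt0 t_lt.
set tau := (s^-1 - 1) / 2 in ts.
pose Z : R := (1 - 2 `^ (1 - alpha * s))^-1.
have zeta H : \sum_(0 <= n < H) n.+1%:R `^ (- (alpha * s)) <= Z by exact: zeta_partial_bound.
have Z0 : 0 <= Z by have := zeta 0%N; rewrite big_geq.
pose b := 2 * Z * C.
have b0 : 0 <= b by rewrite !mulr_ge0.
pose c0 : R := 4 * 9 `^ t * Num.max 1 ((tau - t) / (1 + t))^-1 `^ (1 + t) *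
  (2 `^ b) `^ (2^-1 + tau).
exists (c0 + 1), (b * (2^-1 + tau)).
move=> d N L z Ms A cardA M d1 N1 L1 Ms1 AE Lle Msconst Ms0le M2 Mlt.
(* (d + 1)^b <= (2 d)^b makes the bound on the weight sum a multiple of a power of d. *)
pose K : R := (2 * d%:R) `^ b.
have d0 : 0 < d%:R :> R by rewrite ltr0n.
have dge1 : 1 <= d%:R :> R by rewrite ler1n.
have K1 : 1 <= K by rewrite -(powRr0 (2 * d%:R)) /K ler_powR//; lra.
have K0 : 0 < K by exact: lt_le_trans K1.
have N0 : 0 < N by exact: lt_le_trans N1.
have wsum G : uniq G -> \sum_(h <- G) korobov_weight alpha (gamma d) h `^ (- s) <= K.
  move=> uG; apply: le_trans (korobov_weight_sum alpha0 (gamma_gt0 d) (ltW s0) uG zeta) _.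
  apply: (@le_trans _ _ (expR (b * ln d.+1%:R))).
    by rewrite ler_expR /b -[leRHS]mulrA ler_wpM2l ?sumC// mulr_ge0.
  have -> : expR (b * ln d.+1%:R) = d.+1%:R `^ b by rewrite /powR pnatr_eq0.
  by apply: ge0_ler_powR; rewrite ?nnegrE//; rewrite -natr1; lra.
have a1 : 1 <= cardA%:R :> R.
  rewrite ler1n cardfs_gt0; apply/fset0Pn; exists 0.
  rewrite in_fset_set; last exact: finite_freq_set.
  by rewrite inE /A /freq_set /mkset korobov_weight0.
have aN : cardA%:R <= N `^ s * K by apply: card_freq_set => //; exact: ltW.
have M0 : 0 < M%:R :> R by rewrite ltr0n (leq_ltn_trans _ M2).
have bound := error_bound a1 N1 K1 s0 s1 t_gt0 ts aN (ler0n _ _) Lle M0 (ltW Mlt).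
apply: (@le_lt_trans _ _ ((1 + L%:R) * tail_bound s K N)%:E).
  apply: ge_ereal_sup => _ [f [fspace f1] <-].
  exact: (korobov_lattice_error (s := s)).
rewrite lte_fin; apply: le_lt_trans bound _.
rewrite ltr_pM2r ?powR_gt0//.
have -> : K `^ (2^-1 + tau) = (2 `^ b) `^ (2^-1 + tau) * d%:R `^ (b * (2^-1 + tau)).
  by rewrite /K powRM ?(ltW d0)// powRM ?powR_ge0// -!powRrM.
rewrite mulrA -/tau -/c0 ltr_pM2r ?powR_gt0//; lra.
Qed.
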